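(* Let $\Omega$ be a bounded domain of $\mathbb{R}^N$ ($N\ge1$) satisfying an inner and an outer sphere condition on $\partial\Omega$. Let $a:\mathbb{R}\to\mathbb{R}^+$ be of class $C^1$ with $a\ge\nu$ on $\mathbb{R}$ for some $\nu>0$, and let $f:\mathbb{R}\to\mathbb{R}$ be of class $C^1$. Let $g:\mathbb{R}\to\mathbb{R}$ be the solution of $g'=1/\sqrt{a\circ g}$, $g(0)=0$, and let $\eta$ denote the unique solution to $$\eta'=-\sqrt{2F\circ g\circ\eta},\qquad \lim_{t\to0^+}\eta(t)=+\infty .$$ Then any solution $u\in C^2(\Omega)$ to $$\mathrm{div}(a(u)Du)=\frac{a'(u)}{2}|Du|^2+f(u)\ \text{ in }\Omega,\qquad u(x)\to+\infty\ \text{ as } d(x,\partial\Omega)\to0$$ satisfies $$u(x)=g\circ\eta(d(x,\partial\Omega))+o(1)$$ whenever $d(x,\partial\Omega)$ goes to zero, provided that one of the following situations occurs, for some $a_\infty>0$ and $f_\infty>0$: (1) $\lim_{s\to+\infty}\frac{a(s)}{s^k}=a_\infty$ and $\lim_{s\to+\infty}\frac{f(s)}{e^{2\beta s}}=f_\infty$ for some $k>0$, $\beta>0$; (2) $\lim_{s\to+\infty}\frac{a(s)}{s^k}=a_\infty$ and $\lim_{s\to+\infty}\frac{f(s)}{s^p}=f_\infty$ for some $k>0$ and $p>2k+3$; (3) $\lim_{s\to+\infty}\frac{a(s)}{e^{2\gamma s}}=a_\infty$ and $\lim_{s\to+\infty}\frac{f(s)}{e^{2\beta s}}=f_\infty$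 for some $\gamma>0$ and $\beta>2\gamma$; (4) $\lim_{s\to+\infty}\frac{a(s)}{(\log s)^{2\gamma}}=a_\infty$ and $\lim_{s\to+\infty}\frac{f(s)}{e^{2\beta s}}=f_\infty$ for some $\gamma>0$, $\beta>0$; (5) $\lim_{s\to+\infty}\frac{a(s)}{(\log s)^{2\gamma}}=a_\infty$ and $\lim_{s\to+\infty}\frac{f(s)}{s^p}=f_\infty$ for some $\gamma>0$ and $p>3$.
   Context: $d(x,\partial\Omega)$ is the distance of $x$ from $\partial\Omega$. $F(t)=\int_r^tf(\tau)\,d\tau$, where $r\in\mathbb{R}$ is such that $f(r)>0$ and $f(s)\ge0$ for all $s>r$ (such $r$ exists in each of the listed situations). The function $\eta$ is defined in a right neighbourhood of $0$, by $\int_{\eta(t)}^{+\infty}\frac{ds}{\sqrt{2F(g(s))}}=t$. *)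

(* Defs.v *)
From HB Require Import structures.
From mathcomp Require Import all_boot all_order all_algebra.
From mathcomp Require Import all_classical all_reals all_analysis.
Set Implicit Arguments.
Unset Strict Implicit.
Unset Printing Implicit Defensive.
Import Order.TTheory GRing.Theory Num.Theory.
Import numFieldNormedType.Exports.
Local Open Scope classical_set_scope.
Local Open Scope ring_scope.

Section functions_of_one_variable.
Variable R : realType.
Implicit Types f : R -> R.

Definition C1 f : Prop := (forall t, derivable f t 1) /\ continuous (derive1 f).

(* The library integral is over an (unoriented) set, hence the case split. *)
Definition primitive_from (r : R) f (t : R) : R :=
  if r <= t then \int[lebesgue_measure]_(s in `[r, t]) f s
  else - \int[lebesgue_measure]_(s in `[t, r]) f s.

End functions_of_one_variable.

Section euclidean_space.
Variables (R : realType) (N : nat).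
Implicit Types (x c : 'rV[R]_N) (A : set 'rV[R]_N) (u : 'rV[R]_N -> R)
  (V : 'rV[R]_N -> 'rV[R]_N).

(* The library norm `|x| of 'rV[R]_N is the sup norm; it induces the same
   topology and the same bounded sets, but not the same balls and distances. *)
Definition enorm x : R := Num.sqrt (\sum_(i < N) x 0 i ^+ 2).

Definition eball c (rho : R) : set 'rV[R]_N := [set x | enorm (x - c) < rho].

Definition frontier A : set 'rV[R]_N := closure A `\` interior A.

Definition dist_to A x : R := inf [set enorm (x - y) | y in A].

Definition is_domain A : Prop := [/\ A !=set0, open A & connected A].

(* The radius is uniform along the boundary. *)
Definition inner_sphere_condition A : Prop :=
  exists2 rho : R, 0 < rho & forall x, frontier A x ->
    exists2 c, enorm (x - c) = rho & eball c rho `<=` A.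

Definition outer_sphere_condition A : Prop :=
  exists2 rho : R, 0 < rho & forall x, frontier A x ->
    exists2 c, enorm (x - c) = rho & eball c rho `<=` ~` closure A.

Definition partial (i : 'I_N) u x : R := 'D_(delta_mx 0 i) u x.

Definition grad u x : 'rV[R]_N := \row_i partial i u x.

Definition divergence V x : R := \sum_(i < N) partial i (fun y => V y 0 i) x.

Definition C2_on A u : Prop := forall x, A x ->
  {for x, continuous u} /\
  forall i : 'I_N,
    [/\ derivable u x (delta_mx 0 i),
        {for x, continuous (partial i u)} &
        forall j : 'I_N, derivable (partial i u) x (delta_mx 0 j) /\
          {for x, continuous (partial j (partial i u))}].

(* The filter "x in A and d(x, frontier A) -> 0". *)
Definition to_frontier A : set_system 'rV[R]_N :=
  filter_from [set delta : R | 0 < delta]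
    (fun delta => [set x | A x /\ dist_to (frontier A) x < delta]).

Global Instance to_frontier_filter A : Filter (to_frontier A).
Proof.
apply: filter_from_filter; first by exists 1 => /=.
move=> d1 d2 /= d1_gt0 d2_gt0; exists (Num.min d1 d2) => /=.
  by rewrite lt_min d1_gt0.
by move=> x /= [Ax]; rewrite lt_min => /andP[lt1 lt2].
Qed.

End euclidean_space.

(* Main.v *)
(** Put [gam = g o eta], so that [gam' = - q] with [a(gam) q^2 = 2 F(gam)], and
    write [u = gam(z)] near the boundary.  The equation becomes
    [laplacian z = B(z) (|grad z|^2 - 1)] with [B = f(gam) / (a(gam) q)], and the
    growth conditions enter only through [B(t) t >= 3/4] and
    [t^2 q(t) -> 0] as [t -> 0].

    The first fact yields [z = d + O(d^2)], [d] the distance to the boundary, by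
    comparison with quadratic functions [w] of [|x - c|^2]: in an interior
    tangent ball with [w = s - K s^2], sliding additively in [w]; outside an
    exterior tangent ball with [w = s + K s^2 / 2], sliding in the variable [s].
    Here [s] agrees with the distance to the sphere up to second order.  The
    second choice satisfies [(dw/ds)^2 = 1 + 2 K w], so both
    comparisons need only the lower bound on [B], and no monotonicity of [f].

    The second fact turns [z = d + O(d^2)] into [gam(z) - gam(d) -> 0]. *)
Require Import Defs.
From HB Require Import structures.
From mathcomp Require Import all_boot all_order all_algebra.
From mathcomp Require Import all_classical all_reals all_analysis.
From mathcomp Require Import ring lra.
Set Implicit Arguments.
Unset Strict Implicit.
Unset Printing Implicit Defensive.
Import Order.TTheory GRing.Theory Num.Theory.
Import numFieldNormedType.Exports.
Local Open Scope classical_set_scope.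
Local Open Scope ring_scope.

(** * Real functions of one variable *)

(** The constant [3/4] only has to exceed [1/2]. For the interior barrier, [1 - |grad w|^2] is at
    least [4 K w] and the Laplacian is at least about [- 2 K]; for the exterior one,
    [|grad w|^2 - 1] is at least [2 K w] and the Laplacian is about [K]; curvature adds a term of
    order [N / rho]. A bound [B(t) t >= b] with [b > 1/2] therefore lets the first-order defect beat
    the Laplacian once [K] is large.

    The two slidings differ because contact evaluates [B] at the value [z] of the shifted barrier. A
    violation inside gives [z < w], so a defect proportional to [w] is still large enough after an
    additive shift. A violation outside gives [z > w], where an additive shift would leave the
    defect too small; shifting the argument [s] keeps slope and value tied together.

    An error [O(d^2)] in [z] is harmless since [gam] has slope [q = o(t^-2)]. The conditions
    [p > 2 k + 3] and [beta > 2 gamma] are those under which the explicit bound [I^2 S] for [t^2 q]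
    vanishes, [a] being bounded below in [q] by [nu] alone. *)

Section calculus.
Variable R : realType.
Implicit Types (f g : R -> R) (a b c s t x : R).

Lemma is_derive_continuous f x df : is_derive (x : R) (1 : R) f df ->
  {for x, continuous f}.
Proof.
by move=> [fx _]; exact/differentiable_continuous/derivable1_diffP.
Qed.

Lemma le_of_derive (f df : R -> R) a b : a <= b ->
  (forall x, a <= x <= b -> is_derive (x : R) (1 : R) f (df x)) ->
  (forall x, a <= x <= b -> 0 <= df x) -> f a <= f b.
Proof.
move=> ab fdf df0.
have cf : {within `[a, b], continuous f}.
  apply: derivable_within_continuous => x; rewrite in_itv/= => xab.
  by have [] := fdf x xab.
have [x|c cab e] := @MVT_segment R f df a b ab _ cf.
  by rewrite in_itv/= => /andP[/ltW ax /ltW xb]; apply: fdf; rewrite ax.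
rewrite -subr_ge0 e mulr_ge0 ?subr_ge0// df0//.
Qed.

(** Only differentiability of [df] at 0 is assumed. If [d2 < 0], then [df] is negative just to the
    right of its zero 0, and the mean value theorem makes [f] drop below [f 0]. *)
Lemma derive_at_local_min (f df : R -> R) (d2 : R) :
  (\forall h \near (0 : R), is_derive (h : R) (1 : R) f (df h)) ->
  is_derive (0 : R) (1 : R) df d2 ->
  (\forall h \near (0 : R), f 0 <= f h) -> df 0 = 0 /\ 0 <= d2.
Proof.
move=> fdf dfd fmin.
have [/= e e0 He] : \forall h \near (0 : R), is_derive (h : R) (1 : R) f (df h) /\ f 0 <= f h.
  by near do split.
have {}He h : `|h| < e -> is_derive (h : R) (1 : R) f (df h) /\ f 0 <= f h.
  by move=> he; apply: He; rewrite /= sub0r normrN.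
have df0 : df 0 = 0.
  have dmin : is_derive (0 : R) (1 : R) f 0.
    apply: (@derive1_at_min R f (- e) e 0) => [|h||h]; rewrite ?in_itv/=.
    - lra.
    - by rewrite -ltr_norml => he; have [[]] := He h he.
    - by rewrite oppr_lt0 e0.
    - by rewrite -ltr_norml => he; have [] := He h he.
  have [[_ <-] _] : is_derive (0 : R) (1 : R) f (df 0) /\ f 0 <= f 0.
    by apply: He; rewrite normr0.
  by have [] := dmin.
split => //; rewrite leNgt; apply/negP => d20.
have [dfdiff dfE] := dfd.
have cv : h^-1 *: (df (h *: 1 + 0) - df 0) @[h --> 0^'] --> d2.
  by rewrite -dfE; exact: dfdiff.
have [/= e2 e20 He2] : \forall h \near (0 : R)^', h^-1 *: (df (h *: 1 + 0) - df 0) < 0.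
  by apply: (cvgr_lt d2).
pose h := Num.min e e2 / 2.
have h0 : 0 < h by rewrite divr_gt0// lt_min e0.
have he : h < e by rewrite /h; case: (leP e e2) => ?; lra.
have he2 : h < e2 by rewrite /h; case: (leP e e2) => ?; lra.
have dfneg c : 0 < c < h -> df c < 0.
  move=> /andP[c0 ch].
  have /= := He2 c; rewrite sub0r normrN gtr0_norm// => /(_ (lt_trans ch he2)).
  rewrite gt_eqF// => /(_ isT).
  rewrite df0 subr0 addr0 [_%:A]mulr1 => H.
  by move: H; rewrite [_ *: _]mulrC pmulr_llt0// invr_gt0.
have cf : {within `[0, h], continuous f}.
  apply: derivable_within_continuous => x; rewrite in_itv/= => /andP[x0 xh].
  have [|[]]// := He x; rewrite ger0_norm//; exact: le_lt_trans xh he.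
have [x|c + e3] := @MVT R f df 0 h h0 _ cf.
  rewrite in_itv/= => /andP[x0 xh].
  by have [|]// := He x; rewrite gtr0_norm//; exact: lt_trans xh he.
rewrite in_itv/= => ch.
have [|_] := He h; first by rewrite gtr0_norm.
rewrite -subr_ge0 e3 subr0 leNgt; apply/negP; rewrite negbK.
by rewrite pmulr_llt0// dfneg.
Unshelve. all: by end_near. Qed.

(* A nondecreasing function is bounded below, hence absorbed by any
   multiple of a function tending to infinity. *)
Lemma near_ge0_of_derive_ge0 (h G dh : R -> R) (eps : R) : 0 < eps ->
  (\forall s \near +oo, is_derive (s : R) (1 : R) h (dh s) /\ 0 <= dh s) ->
  G s @[s --> +oo] --> +oo ->
  \forall s \near +oo, 0 <= h s + eps * G s.
Proof.
move=> eps0 [s0 [s0r Hs0]] Gy; near=> s.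
have hs : h (s0 + 1) <= h s.
  apply: (@le_of_derive h dh); first by near: s; apply: nbhs_pinfty_ge; rewrite num_real.
    by move=> x /andP[x1 _]; have [] := Hs0 x _ => //; apply: lt_le_trans x1; rewrite ltrDl.
  by move=> x /andP[x1 _]; have [] := Hs0 x _ => //; apply: lt_le_trans x1; rewrite ltrDl.
have : - h (s0 + 1) / eps < G s by near: s; exact: (cvgry_gt Gy).
rewrite ltr_pdivrMr// mulrC => ?; lra.
Unshelve. all: by end_near. Qed.

Lemma primitive_from_derive r f t : continuous f -> r < t ->
  is_derive (t : R) (1 : R) (primitive_from r f) (f t).
Proof.
move=> cf rt.
(* The endpoint [t + 1] serves only to make [t] an interior point of the interval of integration. *)
have intf : lebesgue_measure.-integrable `[r, t + 1] (EFin \o f).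
  apply: continuous_compact_integrable; first exact: segment_compact.
  exact: continuous_subspaceT.
have [|d1 d2] := @continuous_FTC1_closed R f r t (t + 1) _ intf rt (cf t).
  by rewrite ltrDl.
rewrite derive1E in d2.
have nearE : \forall x \near t,
    (\int[lebesgue_measure]_(s in [set` `[r, x]]) f s)%R = primitive_from r f x.
  near=> x; rewrite /primitive_from ifT//; apply: ltW; near: x.
  exact: lt_nbhsr.
by rewrite -d2; apply: (near_eq_is_derive nearE) => //; exact: derivableP.
Unshelve. all: by end_near. Qed.

End calculus.

(** * The boundary profile and its growth *)

Section profile_near_boundary.
Variable R : realType.

(* [S] stands for the square root of a primitive of [f0], so [J] and [I]
   dominate the tails of [1 / S] and [sqrt a / S] *)
Definition growth_profile (a f : R -> R) : Prop :=
  exists (c : R) (S f0 J alpha I : R -> R),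
  [/\ 0 < c, f s / f0 s @[s --> +oo] --> c,
      S s @[s --> +oo] --> +oo, J s @[s --> +oo] --> 0 &
      I s ^+ 2 * S s @[s --> +oo] --> 0] /\
  \forall s \near +oo,
    [/\ 0 < f0 s, is_derive (s : R) (1 : R) (fun s => S s ^+ 2) (f0 s),
        is_derive (s : R) (1 : R) J (- (S s)^-1) &
        2 * S s <= f0 s * J s] /\
    [/\ 0 <= alpha s, a s <= alpha s ^+ 2, 0 <= I s &
        is_derive (s : R) (1 : R) I (- (alpha s / S s))].

Variables (a f F gam : R -> R) (nu : R).
Hypothesis nu_gt0 : 0 < nu.
Hypothesis a_ge_nu : forall s, nu <= a s.
(* Any factor close to 1 would do: its square root 9/10 enters the bound 3/4
   of [profile_asymptotics], which only has to exceed 1/2. *)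
Hypothesis a_mono : \forall s0 \near +oo, forall s, s0 <= s ->
  81 / 100 * a s0 <= a s.
Hypothesis F_derive : \forall s \near +oo, is_derive (s : R) (1 : R) F (f s).
Let q t := Num.sqrt (2 * F (gam t)) / Num.sqrt (a (gam t)).
Hypothesis gam_derive :
  \forall t \near (0 : R)^'+, is_derive (t : R) (1 : R) gam (- q t).
Hypothesis gam_lim : gam t @[t --> 0^'+] --> +oo.
Hypothesis prof : growth_profile a f.

Let a_gt0 s : 0 < a s. Proof. exact: lt_le_trans (a_ge_nu s). Qed.

(** Up to constants [sqrt (2 F)] is [S], so along [gam' = - q] the derivative of [J o gam] is at
    most of order [1 / sqrt a], and that of [I o gam] is bounded below. Integrating over [(0, t)]
    gives [J (gam t) sqrt a <= C t] and [t <= C I (gam t)]. The first, fed into [2 S <= f0 J],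
    bounds [f t] from below; the second bounds [t^2 q] by a multiple of [I^2 S]. *)
Lemma profile_asymptotics :
  [/\ \forall t \near (0 : R)^'+, 0 < F (gam t),
      \forall t \near (0 : R)^'+, 3 / 4 * (a (gam t) * q t) <= f (gam t) * t &
      t ^+ 2 * q t @[t --> 0^'+] --> 0].
Proof.
have [c [S [f0 [J [alpha [I [[c0 ff0 Sy J0 IS0] Hs]]]]]]] := prof.
(* The final ratio is [9/10 * (1 - e) / (1 + e) = 57/70], which exceeds [3/4]. *)
pose e : R := 1 / 20.
have e0 : 0 < e by rewrite /e; lra.
have fub : \forall s \near +oo, f s / f0 s < (1 + e / 2) * c.
  by apply: (cvgr_lt c) => //; rewrite /e; nra.
have flb : \forall s \near +oo, (1 - e / 2) * c < f s / f0 s.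
  by apply: (cvgr_gt c) => //; rewrite /e; nra.
(* Integrating the bound on [f / f0] leaves an unknown constant. It is absorbed in [e / 2 * c * S],
   which in turn is at most [e / 2 * c * S ^+ 2] once [S > 1]; hence the passage from [e / 2] to
   [e]. *)
have Fub : \forall s \near +oo,
    0 <= ((1 + e / 2) * c * S s ^+ 2 - F s) + e / 2 * c * S s.
  apply: (@near_ge0_of_derive_ge0 _ _ _ (fun s => (1 + e / 2) * c * f0 s - f s)).
  - by rewrite /e; nra.
  - near=> s; split; last first.
      have : f s / f0 s < (1 + e / 2) * c by near: s.
      rewrite ltr_pdivrMr; first by move=> /ltW; rewrite subr_ge0.
      by near: s; apply: filterS Hs => s [[]].
    have ? : is_derive (s : R) (1 : R) F (f s) by near: s.
    have ? : is_derive (s : R) (1 : R) (fun s => S s ^+ 2) (f0 s).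
      by near: s; apply: filterS Hs => s [[]].
    exact: (@is_deriveB _ _ _ (fun s => (1 + e / 2) * c * S s ^+ 2)).
  - exact: Sy.
have Flb : \forall s \near +oo,
    0 <= (F s - (1 - e / 2) * c * S s ^+ 2) + e / 2 * c * S s.
  apply: (@near_ge0_of_derive_ge0 _ _ _ (fun s => f s - (1 - e / 2) * c * f0 s)).
  - by rewrite /e; nra.
  - near=> s; split; last first.
      have : (1 - e / 2) * c < f s / f0 s by near: s.
      rewrite ltr_pdivlMr; first by move=> /ltW; rewrite subr_ge0.
      by near: s; apply: filterS Hs => s [[]].
    have ? : is_derive (s : R) (1 : R) F (f s) by near: s.
    have ? : is_derive (s : R) (1 : R) (fun s => S s ^+ 2) (f0 s).
      by near: s; apply: filterS Hs => s [[]].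
    exact: (@is_deriveB _ _ _ F (fun s => (1 - e / 2) * c * S s ^+ 2)).
  - exact: Sy.
pose k := Num.sqrt (2 * ((1 + e) * c)).
pose k' := Num.sqrt (2 * ((1 - e) * c)).
have k0 : 0 < k by rewrite sqrtr_gt0 /e; nra.
have k'0 : 0 < k' by rewrite sqrtr_gt0 /e; nra.
have [s1 [_ H1]] : \forall s \near +oo,
  [/\ 0 < S s, Num.sqrt (2 * F s) <= k * S s, k' * S s <= Num.sqrt (2 * F s),
      (1 - e) * c * f0 s <= f s & 0 < f0 s].
  have HS : \forall s \near +oo, 1 < S s by exact: (cvgry_gt Sy 1).
  near=> s.
  have S1 : 1 < S s by near: s.
  have f00 : 0 < f0 s by near: s; apply: filterS Hs => s [[]].
  have Fu : 0 <= ((1 + e / 2) * c * S s ^+ 2 - F s) + e / 2 * c * S s by near: s.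
  have Fl : 0 <= (F s - (1 - e / 2) * c * S s ^+ 2) + e / 2 * c * S s by near: s.
  have fl : (1 - e / 2) * c < f s / f0 s by near: s.
  have SS : e / 2 * c * S s <= e / 2 * c * S s ^+ 2.
    by apply: ler_wpM2l; [rewrite /e; nra|nra].
  have S0 : 0 <= S s by lra.
  split => //.
  - by lra.
  - rewrite -[S s]gtr0_norm ?(lt_trans _ S1)// -sqrtr_sqr -sqrtrM; last by rewrite /e; nra.
    by apply: ler_wsqrtr; lra.
  - rewrite -[S s]gtr0_norm ?(lt_trans _ S1)// -sqrtr_sqr -sqrtrM; last by rewrite /e; nra.
    by apply: ler_wsqrtr; lra.
  - rewrite ltr_pdivlMr// in fl; apply: le_trans (ltW fl).
    by rewrite ler_pM2r// /e; nra.
have [s2 [_ H2]] := Hs.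
have [s3 [_ H3]] := a_mono.
have [t0 /= t00 Ht] : \forall t \near (0 : R)^'+,
    [/\ s1 < gam t, s2 < gam t, s3 < gam t &
        is_derive (t : R) (1 : R) gam (- q t)].
  have G1 : \forall t \near (0 : R)^'+, s1 < gam t by exact: (cvgry_gt gam_lim s1).
  have G2 : \forall t \near (0 : R)^'+, s2 < gam t by exact: (cvgry_gt gam_lim s2).
  have G3 : \forall t \near (0 : R)^'+, s3 < gam t by exact: (cvgry_gt gam_lim s3).
  by near do split.
have {}Ht t : 0 < t < t0 -> [/\ s1 < gam t, s2 < gam t, s3 < gam t &
        is_derive (t : R) (1 : R) gam (- q t)].
  by move=> /andP[t_gt0 tt0]; apply: Ht => //=; rewrite sub0r normrN gtr0_norm.
have q_ge0 t : 0 <= q t by rewrite divr_ge0// sqrtr_ge0.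
have gam_anti t t1 : 0 < t -> t <= t1 -> t1 < t0 -> gam t1 <= gam t.
  move=> t_gt0 tt1 t1t0; rewrite -lerN2.
  apply: (@le_of_derive _ (fun t => - gam t) q) => // x /andP[tx xt1].
  have [|_ _ _ ?] := Ht x; first by rewrite (lt_le_trans t_gt0 tx) (le_lt_trans xt1).
  by rewrite -[q x]opprK; exact: is_deriveN.
have sqrtaE t : Num.sqrt (a (gam t)) ^+ 2 = a (gam t).
  by rewrite sqr_sqrtr// ltW.
have sqrta0 t : 0 < Num.sqrt (a (gam t)) by rewrite sqrtr_gt0.
(* The derivative of [J o gam] is [q / S <= k / sqrt (a (gam x))]. Since [gam x >= gam t1], [a_mono]
   replaces [x] by the endpoint [t1] at the cost of the factor [9/10]. The initial value [J (gam t)]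
   is below any [d] for small [t]. *)
have tJ t1 : 0 < t1 < t0 ->
    9 / 10 * Num.sqrt (a (gam t1)) * J (gam t1) <= k * t1.
  move=> /andP[t10 t1t0].
  pose K := k / (9 / 10 * Num.sqrt (a (gam t1))).
  have K0 : 0 < K by rewrite divr_gt0// mulr_gt0//; lra.
  suff : J (gam t1) <= K * t1.
    by rewrite /K mulrAC ler_pdivlMr ?mulr_gt0// mulrC.
  apply/ler_addgt0Pr => d d0.
  have Jg : J (gam t) @[t --> 0^'+] --> 0 by exact: cvg_comp gam_lim J0.
  have [t [tt1 t_gt0 Jt]] : exists t, [/\ t < t1, 0 < t & J (gam t) < d].
    have Jd : \forall t \near (0 : R)^'+, J (gam t) < d by exact: (cvgr_lt (0 : R) Jg _ d0).
    near (0 : R)^'+ => t; exists t; split; near: t.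
    - exact: nbhs_right_lt.
    - exact: nbhs_right_gt.
    - exact: Jd.
  suff : K * t - J (gam t) <= K * t1 - J (gam t1).
    have : 0 <= K * t by rewrite mulr_ge0// ltW.
    move: Jt; lra.
  have xr x : t <= x <= t1 -> 0 < x < t0.
    by move=> /andP[? ?]; rewrite (lt_le_trans t_gt0)//= (le_lt_trans _ t1t0).
  apply: (@le_of_derive _ (fun t => K * t - J (gam t))
     (fun t => K - (S (gam t))^-1 * q t)) => [|x xt|x xt]; first exact: ltW.
    have [_ x2 _ ?] := Ht x (xr x xt).
    have [[_ _ dJ _] _] := H2 _ x2.
    have dJg := is_derive1_comp dJ.
    have -> : K - (S (gam x))^-1 * q x = K *: 1 - (- (S (gam x))^-1 * - q x).
      by rewrite mulrNN [_ *: _]mulr1.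
    by apply: is_deriveB; exact: dJg.
  have [x1 x2 x3 _] := Ht x (xr x xt).
  have [S0 Fx _ _ _] := H1 _ x1.
  rewrite subr_ge0 mulrC ler_pdivrMr// /q ler_pdivrMr//.
  apply: (le_trans Fx); rewrite mulrAC ler_wpM2r//; first exact: ltW.
  rewrite /K mulrAC ler_pdivlMr ?mulr_gt0//.
  rewrite ler_pM2l//.
  have : 81 / 100 * a (gam t1) <= a (gam x).
    apply: H3; first by have [|] := Ht t1; rewrite ?t10.
    have /andP[tx xt1] := xt.
    by apply: gam_anti => //; exact: lt_le_trans t_gt0 tx.
  move=> /ler_wsqrtr; rewrite sqrtrM; last by lra.
  suff -> : Num.sqrt (81 / 100) = 9 / 10 :> R by [].
  have -> : (81 / 100 : R) = (9 / 10) ^+ 2 by field.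
  by rewrite sqrtr_sqr ger0_norm//; lra.
(* In the derivative [alpha q / S] of [I o gam], [alpha >= sqrt a] cancels the denominator of [q],
   which leaves at least [k']. No limit of [I] is involved: the initial value is merely
   nonnegative. *)
have tI t1 : 0 < t1 < t0 -> k' * t1 <= I (gam t1).
  move=> /andP[t10 t1t0].
  apply/ler_addgt0Pr => d d0.
  have [t [tt1 t_gt0 td]] : exists t, [/\ t < t1, 0 < t & k' * t < d].
    near (0 : R)^'+ => t; exists t; split.
    - by near: t; exact: nbhs_right_lt.
    - by near: t; exact: nbhs_right_gt.
    - rewrite mulrC -ltr_pdivlMr//; near: t.
      by apply: nbhs_right_lt; rewrite divr_gt0.
  have xr x : t <= x <= t1 -> 0 < x < t0.
    by move=> /andP[? ?]; rewrite (lt_le_trans t_gt0)//= (le_lt_trans _ t1t0).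
  have It : 0 <= I (gam t).
    have [_ x2 _ _] : [/\ s1 < gam t, s2 < gam t, s3 < gam t &
        is_derive (t : R) (1 : R) gam (- q t)].
      by apply/Ht/xr; rewrite lexx ltW.
    by have [_ []] := H2 _ x2.
  suff : I (gam t) - k' * t <= I (gam t1) - k' * t1 by move: td; lra.
  apply: (@le_of_derive _ (fun t => I (gam t) - k' * t)
     (fun t => alpha (gam t) / S (gam t) * q t - k')) => [|x xt|x xt]; first exact: ltW.
    have [_ x2 _ ?] := Ht x (xr x xt).
    have [_ [_ _ _ dI]] := H2 _ x2.
    have dIg := is_derive1_comp dI.
    have -> : alpha (gam x) / S (gam x) * q x - k' =
      (- (alpha (gam x) / S (gam x)) * - q x) - k' *: 1.
      by rewrite mulrNN [_ *: _]mulr1.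
    by apply: (@is_deriveB _ _ _ (I \o gam)).
  have [x1 x2 x3 _] := Ht x (xr x xt).
  have [S0 _ Fx _ _] := H1 _ x1.
  have [_ [al0 aal _ _]] := H2 _ x2.
  rewrite subr_ge0 mulrAC ler_pdivlMr// /q mulrA ler_pdivlMr// [leRHS]mulrC.
  apply: ler_pM => //; first by rewrite mulr_ge0// ltW.
  by rewrite -(ger0_norm al0) -sqrtr_sqr ler_wsqrtr.
split.
- near=> t.
  have tt : 0 < t < t0.
    by apply/andP; split; near: t; [exact: nbhs_right_gt|exact: nbhs_right_lt].
  have [x1 _ _ _] := Ht t tt.
  have [S0 _ Fx _ _] := H1 _ x1.
  have : 0 < Num.sqrt (2 * F (gam t)) by apply: lt_le_trans Fx; exact: mulr_gt0.
  by rewrite sqrtr_gt0; lra.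
- near=> t.
  have tt : 0 < t < t0.
    by apply/andP; split; near: t; [exact: nbhs_right_gt|exact: nbhs_right_lt].
  have [x1 x2 _ _] := Ht t tt.
  have [S0 Fx _ fx f00] := H1 _ x1.
  have [[_ _ _ SJ] _] := H2 _ x2.
  have /andP[t_gt0 _] := tt.
  have J_ge0 : 0 <= J (gam t).
    by move: SJ; rewrite -ler_pdivrMl//; apply: le_trans;
      rewrite mulr_ge0 ?invr_ge0 ?ltW ?mulr_gt0.
  set s := gam t; set A := Num.sqrt (a s).
  have A0 : 0 < A by exact: sqrta0.
  have -> : a s * q t = Num.sqrt (2 * F s) * A.
    by rewrite /q -/s -/A -(sqrtaE t) -/s -/A; field; rewrite gt_eqF.
  have h1 : 9 / 10 * A * J s <= k * t := tJ t tt.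
  have kk : k ^+ 2 = 2 * ((1 + e) * c) by rewrite sqr_sqrtr// /e; nra.
  rewrite -(ler_pM2l k0).
  have h2 : (1 - e) * c * f0 s * (9 / 10 * A * J s) <= f s * (k * t).
    by apply: ler_pM => //; rewrite ?mulr_ge0// ?ltW// /e; lra.
  have h3 : (1 - e) * c * (9 / 10 * A) * (2 * S s) <=
            (1 - e) * c * (9 / 10 * A) * (f0 s * J s).
    by apply: ler_wpM2l => //; rewrite ?mulr_ge0// ?ltW// /e; lra.
  have h4 : k * (3 / 4 * (Num.sqrt (2 * F s) * A)) <= k * (3 / 4 * (k * S s * A)).
    by rewrite ler_pM2l// ler_pM2l; [rewrite ler_pM2r|lra].
  apply: (le_trans h4).
  have -> : k * (f s * t) = f s * (k * t) by ring.
  apply: le_trans h2.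
  have -> : (1 - e) * c * f0 s * (9 / 10 * A * J s) =
     (1 - e) * c * (9 / 10 * A) * (f0 s * J s) by ring.
  apply: le_trans h3.
  have -> : k * (3 / 4 * (k * S s * A)) = k ^+ 2 * (3 / 4) * (S s * A) by ring.
  have -> : (1 - e) * c * (9 / 10 * A) * (2 * S s) =
     (1 - e) * c * (9 / 10) * 2 * (S s * A) by ring.
  by rewrite kk ler_pM2r ?mulr_gt0// /e; nra.
have IS : (I (gam t) ^+ 2 * S (gam t)) * (k / k' ^+ 2 / Num.sqrt nu) @[t --> 0^'+] --> 0.
  rewrite -[X in _ --> X](mul0r (k / k' ^+ 2 / Num.sqrt nu)).
  by apply: cvgMl; exact: (cvg_comp _ _ gam_lim IS0).
apply: (squeeze_cvgr _ (cvg_cst 0) IS); near=> t.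
have tt : 0 < t < t0.
  by apply/andP; split; near: t; [exact: nbhs_right_gt|exact: nbhs_right_lt].
have [x1 x2 _ _] := Ht t tt.
have [S0 Fx _ _ _] := H1 _ x1.
have /andP[t_gt0 _] := tt.
rewrite mulr_ge0 ?sqr_ge0//=.
have nus : 0 < Num.sqrt nu by rewrite sqrtr_gt0.
have h1 : (k' * t) ^+ 2 <= I (gam t) ^+ 2.
  by have h := tI t tt; rewrite ler_pXn2r// nnegrE ?(le_trans _ h)// mulr_ge0 ?ltW.
have h2 : q t <= k * S (gam t) / Num.sqrt nu.
  rewrite /q; apply: ler_pM => //; rewrite ?invr_ge0 ?sqrtr_ge0//.
  by rewrite lef_pV2 ?posrE// ler_wsqrtr.
have h3 : t ^+ 2 <= I (gam t) ^+ 2 / k' ^+ 2.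
  by rewrite ler_pdivlMr ?exprn_gt0// mulrC -exprMn.
apply: le_trans (ler_pM _ _ h3 h2) _ => //; first exact: sqr_ge0.
by rewrite le_eqVlt; apply/orP; left; apply/eqP; field; rewrite !gt_eqF.
Unshelve. all: by end_near. Qed.

End profile_near_boundary.

(** * Explicit growth profiles in the five situations *)

Section growth.
Variable R : realType.
Implicit Types (a f : R -> R) (b x c A : R).

Lemma powR_cvgy b : 0 < b -> s `^ b @[s --> +oo] --> +oo.
Proof.
move=> b0; apply/cvgryPge => A; near=> s.
pose M := Num.max A 1.
have M1 : 1 <= M by rewrite le_max lexx orbT.
have M0 : 0 <= M by rewrite (le_trans _ M1).
have : M `^ b^-1 <= s by near: s; apply: nbhs_pinfty_ge; rewrite num_real.
move=> Ms; apply: (@le_trans _ _ M); first by rewrite le_max lexx.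
rewrite -[leLHS](powRr1 M0) -(mulVf (lt0r_neq0 b0)) powRrM.
by apply: ge0_ler_powR => //; rewrite ?ltW// nnegrE ?powR_ge0// (le_trans _ Ms)// powR_ge0.
Unshelve. all: by end_near. Qed.

Lemma powRN_cvg0 b : 0 < b -> s `^ (- b) @[s --> +oo] --> 0.
Proof.
move=> b0; under eq_fun do rewrite powRN.
apply/gtr0_cvgV0; last exact: powR_cvgy.
near=> s; apply: powR_gt0; near: s; exact: nbhs_pinfty_gt.
Unshelve. all: by end_near. Qed.

Lemma expRM_cvgy b : 0 < b -> expR (b * s) @[s --> +oo] --> +oo.
Proof.
move=> b0; apply/cvgryPge => A; near=> s.
apply: le_trans (expR_ge1Dx _).
have : A / b <= s by near: s; apply: nbhs_pinfty_ge; rewrite num_real.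
rewrite ler_pdivrMr// mulrC => ?; lra.
Unshelve. all: by end_near. Qed.

Lemma expRMN_cvg0 b : 0 < b -> expR (- b * s) @[s --> +oo] --> 0.
Proof.
move=> b0; under eq_fun do rewrite mulNr expRN.
apply/gtr0_cvgV0; last exact: expRM_cvgy.
by near=> s; exact: expR_gt0.
Unshelve. all: by end_near. Qed.

Lemma is_derive_cM c f x df : is_derive (x : R) (1 : R) f df ->
  is_derive (x : R) (1 : R) (fun s => c * f s) (c * df).
Proof. by move=> fx; exact: (@is_deriveZ _ _ _ f). Qed.

Lemma is_derive_cpowR c b x : 0 < x ->
  is_derive (x : R) (1 : R) (fun s => c * s `^ b) (c * (b * x `^ (b - 1))).
Proof. by move=> x0; apply: is_derive_cM; exact: is_derive1_powR. Qed.

Lemma is_derive_cexpR c b x :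
  is_derive (x : R) (1 : R) (fun s => c * expR (b * s)) (c * (b * expR (b * x))).
Proof.
apply: is_derive_cM; rewrite mulrC.
apply: (@is_derive1_comp _ expR (fun s => b * s)).
rewrite -[X in is_derive _ _ _ X]mulr1.
by apply: is_derive_cM; exact: is_derive_id.
Qed.

(** With [p = 2 b - 1] and [S = s^b], the functions [J] and [I] are the exact tails of [1 / S] and
    [sqrt A s^e / S]. Then [I^2 S] is a multiple of [s^(2 e + 2 - b)], and [b > 2 e + 2] is the
    hypothesis [p > 4 e + 3]. *)
Lemma power_profile a f c A e p : 0 < c -> 0 < A -> 0 <= e -> 4 * e + 3 < p ->
  f s / s `^ p @[s --> +oo] --> c ->
  (\forall s \near +oo, a s <= A * s `^ (2 * e)) ->
  growth_profile a f.
Proof.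
move=> c0 A0 e0 pe fc aA.
have [b p2] : exists b, p = b * 2 - 1 by exists ((p + 1) / 2); field.
have b0 : 0 < b by lra.
have b1 : 0 < b - 1 by lra.
have be : 0 < b - 1 - e by lra.
have b2e : 0 < b - 2 * e - 2 by lra.
exists (c / (b * 2)), (fun s => s `^ b), (fun s => b * 2 * s `^ p),
  (fun s => (b - 1)^-1 * s `^ (1 - b)), (fun s => Num.sqrt A * s `^ e),
  (fun s => Num.sqrt A / (b - 1 - e) * s `^ (e + 1 - b)).
split.
  split.
  - by rewrite divr_gt0// mulr_gt0.
  - have -> : (fun s => f s / (b * 2 * s `^ p)) = (fun s => f s / s `^ p * (b * 2)^-1).
      by apply/funext => s; rewrite invfM mulrCA mulrC.
    by apply: cvgMl.
  - exact: powR_cvgy.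
  - rewrite -[X in _ --> X](mulr0 (b - 1)^-1); apply: cvgMr.
    by rewrite -opprB; exact: powRN_cvg0.
  - have H : (Num.sqrt A / (b - 1 - e)) ^+ 2 * s `^ (- (b - 2 * e - 2)) @[s --> +oo] --> 0.
      rewrite -[X in _ --> X](mulr0 ((Num.sqrt A / (b - 1 - e)) ^+ 2)); apply: cvgMr.
      exact: powRN_cvg0.
    apply: cvg_trans H; apply: near_eq_cvg; near=> s.
    have s0 : 0 < s by near: s; exact: nbhs_pinfty_gt.
    rewrite [in RHS]exprMn -[in RHS]mulrA; congr (_ * _).
    have -> : - (b - 2 * e - 2) = ((e + 1 - b) * 2) + b by ring.
    by rewrite powRD ?(gt_eqF s0) ?implybT// powRrM -powR_mulrn ?powR_ge0.
near=> s.
have s0 : 0 < s by near: s; exact: nbhs_pinfty_gt.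
have sx x y : s `^ (x + y) = s `^ x * s `^ y.
  by rewrite powRD ?(gt_eqF s0) ?implybT.
split; split => //.
- by apply: mulr_gt0; [exact: mulr_gt0|exact: powR_gt0].
- have -> : (fun s : R => (s `^ b) ^+ 2) = (fun s => 1 * s `^ (b * 2)).
    by apply/funext => x; rewrite mul1r powRrM -powR_mulrn ?powR_ge0.
  by rewrite -[_ * _ * _]mul1r p2; exact: is_derive_cpowR.
- have -> : - (s `^ b)^-1 = (b - 1)^-1 * ((1 - b) * s `^ (1 - b - 1)).
    have -> : 1 - b - 1 = - b by ring.
    by rewrite powRN; field; rewrite !gt_eqF// powR_gt0.
  exact: is_derive_cpowR.
- have -> : b * 2 * s `^ p * ((b - 1)^-1 * s `^ (1 - b)) = (b / (b - 1)) * (2 * s `^ b).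
    have -> : s `^ b = s `^ p * s `^ (1 - b).
      by rewrite -sx; congr (_ `^ _); rewrite p2; ring.
    by field; rewrite gt_eqF.
  rewrite ler_peMl ?mulr_ge0 ?powR_ge0// ler_pdivlMr//; lra.
- by rewrite mulr_ge0 ?sqrtr_ge0 ?powR_ge0.
- rewrite exprMn sqr_sqrtr ?(ltW A0)// -powR_mulrn ?powR_ge0// -powRrM [e * _]mulrC.
  by near: s.
- by rewrite mulr_ge0 ?powR_ge0// divr_ge0 ?sqrtr_ge0// ltW.
- have -> : - (Num.sqrt A * s `^ e / s `^ b) =
     Num.sqrt A / (b - 1 - e) * ((e + 1 - b) * s `^ (e + 1 - b - 1)).
    have -> : e + 1 - b - 1 = e + - b by ring.
    rewrite sx powRN; field; rewrite !gt_eqF// powR_gt0//.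
  exact: is_derive_cpowR.
Unshelve. all: by end_near. Qed.

(** The same tails for [S = exp (b s)]: here [f0 J = 2 S] exactly, and [I^2 S] is a multiple of
    [exp ((2 g - b) s)], which tends to 0 because [2 g < b]. *)
Lemma exponential_profile a f c A g b : 0 < c -> 0 < A -> 0 <= g -> 2 * g < b ->
  f s / expR (2 * b * s) @[s --> +oo] --> c ->
  (\forall s \near +oo, a s <= A * expR (2 * g * s)) ->
  growth_profile a f.
Proof.
move=> c0 A0 g0 gb fc aA.
have b0 : 0 < b by lra.
have bg : 0 < b - g by lra.
exists (c / (2 * b)), (fun s => expR (b * s)), (fun s => 2 * b * expR (2 * b * s)),
  (fun s => b^-1 * expR (- b * s)), (fun s => Num.sqrt A * expR (g * s)),
  (fun s => Num.sqrt A / (b - g) * expR (- (b - g) * s)).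
have expR_sqr x s : expR (x * s) ^+ 2 = expR (2 * x * s).
  by rewrite -expRM_natl mulrA.
split.
  split.
  - by rewrite divr_gt0// mulr_gt0.
  - have -> : (fun s => f s / (2 * b * expR (2 * b * s))) =
      (fun s => f s / expR (2 * b * s) * (2 * b)^-1).
      by apply/funext => s; rewrite invfM mulrCA mulrC.
    by apply: cvgMl.
  - exact: expRM_cvgy.
  - by rewrite -[X in _ --> X](mulr0 b^-1); apply: cvgMr; exact: expRMN_cvg0.
  - have -> : (fun s => (Num.sqrt A / (b - g) * expR (- (b - g) * s)) ^+ 2 * expR (b * s))
      = (fun s => (Num.sqrt A / (b - g)) ^+ 2 * expR (- (b - 2 * g) * s)).
      apply/funext => s; rewrite exprMn -mulrA expR_sqr -expRD.
      by congr (_ * expR _); ring.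
    rewrite -[X in _ --> X](mulr0 ((Num.sqrt A / (b - g)) ^+ 2)); apply: cvgMr.
    by apply: expRMN_cvg0; lra.
near=> s; split; split => //.
- by apply: mulr_gt0; [exact: mulr_gt0|exact: expR_gt0].
- have -> : (fun s : R => expR (b * s) ^+ 2) = (fun s => 1 * expR (2 * b * s)).
    by apply/funext => x; rewrite mul1r expR_sqr.
  by rewrite -[_ * _ * _]mul1r; exact: is_derive_cexpR.
- have -> : - (expR (b * s))^-1 = b^-1 * (- b * expR (- b * s)).
    by rewrite [- b * s]mulNr expRN; field; rewrite !gt_eqF// expR_gt0.
  exact: is_derive_cexpR.
- rewrite -expR_sqr mulNr expRN le_eqVlt; apply/orP; left; apply/eqP.
  by field; rewrite !gt_eqF// expR_gt0.
- rewrite exprMn sqr_sqrtr ?(ltW A0)// expR_sqr.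
  by near: s.
- by rewrite mulr_ge0 ?expR_ge0// divr_ge0 ?sqrtr_ge0// ltW.
- have -> : - (Num.sqrt A * expR (g * s) / expR (b * s)) =
     Num.sqrt A / (b - g) * (- (b - g) * expR (- (b - g) * s)).
    have -> : - (b - g) * s = g * s - b * s by ring.
    by rewrite expRB; field; rewrite !gt_eqF// expR_gt0.
  exact: is_derive_cexpR.
Unshelve. all: by end_near. Qed.

(** Far out, [a] stays within 5 percent of [c * a0] with [a0] nondecreasing, and
    [81/100 * 105 <= 95]. *)
Lemma almost_nondecreasing a a0 c : 0 < c ->
  a s / a0 s @[s --> +oo] --> c ->
  (\forall s0 \near +oo, 0 < a0 s0 /\ forall s, s0 <= s -> a0 s0 <= a0 s) ->
  \forall s0 \near +oo, forall s, s0 <= s -> 81 / 100 * a s0 <= a s.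
Proof.
move=> c0 aa0 a0_mono.
have [s1 [_ H1]] : \forall s \near +oo, 95 / 100 * c < a s / a0 s < 105 / 100 * c.
  near=> s; apply/andP; split; near: s.
    by apply: (cvgr_gt c) => //; lra.
  by apply: (cvgr_lt c) => //; lra.
have [s2 [_ H2]] := a0_mono.
near=> s0.
have s01 : s1 < s0 by near: s0; apply: nbhs_pinfty_gt; rewrite num_real.
have s02 : s2 < s0 by near: s0; apply: nbhs_pinfty_gt; rewrite num_real.
move=> s s0s.
have [p0 m0] := H2 _ s02.
have [p1 _] := H2 _ (lt_le_trans s02 s0s).
have /andP[_] := H1 _ s01; rewrite ltr_pdivrMr// => h0.
have /andP[+ _] := H1 _ (lt_le_trans s01 s0s); rewrite ltr_pdivlMr// => h1.
have h2 : c * a0 s0 <= c * a0 s by rewrite ler_pM2l// m0.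
have h3 : 0 <= c * a0 s0 by rewrite mulr_ge0 ?ltW.
move: h0 h1 h2 h3; lra.
Unshelve. all: by end_near. Qed.

Lemma near_le_of_ratio_cvg a a0 c : 0 < c ->
  a s / a0 s @[s --> +oo] --> c -> (\forall s \near +oo, 0 < a0 s) ->
  \forall s \near +oo, a s <= 2 * c * a0 s.
Proof.
move=> c0 aa0 a0_gt0.
have H : \forall s \near +oo, a s / a0 s < 2 * c.
  by apply: (cvgr_lt c) => //; lra.
near=> s; have s0 : 0 < a0 s by near: s.
have : a s / a0 s < 2 * c by near: s.
by rewrite ltr_pdivrMr// => /ltW.
Unshelve. all: by end_near. Qed.

(** This is [x <= exp x] at [x = b s / k], raised to the power [k]. *)
Lemma powR_le_expR k b s : 0 < k -> 0 < b -> 0 < s ->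
  s `^ k <= (b / k) `^ (- k) * expR (b * s).
Proof.
move=> k0 b0 s0.
have bk : 0 < b / k by rewrite divr_gt0.
rewrite powRN ler_pdivlMl ?powR_gt0// -powRM ?(ltW bk) ?(ltW s0)//.
have -> : b * s = b / k * s * k by field; rewrite gt_eqF.
rewrite expRM; apply: ge0_ler_powR; rewrite ?nnegrE ?expR_ge0 ?ltW//.
  by rewrite mulr_gt0.
by apply: lt_le_trans (expR_ge1Dx _); rewrite ltrDr.
Qed.

Lemma lnX_le_powR k b s : 0 < k -> 0 < b -> 1 < s ->
  ln s `^ k <= (b / k) `^ (- k) * s `^ b.
Proof.
move=> k0 b0 s1; have s0 : 0 < s by lra.
have := powR_le_expR k0 b0 (ln_gt0 s1).
by have -> : expR (b * ln s) = s `^ b by rewrite mulrC expRM lnK.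
Qed.

(** Only an upper bound on [a] matters for the profile, so powers and logarithms can be dominated by
    a slow exponential or a small power. This leaves the two model profiles. *)
Lemma situations_growth_profile a f (a_inf f_inf : R) : 0 < a_inf -> 0 < f_inf ->
    [\/ exists k beta : R, [/\ 0 < k, 0 < beta,
          a s / s `^ k @[s --> +oo] --> a_inf &
          f s / expR (2 * beta * s) @[s --> +oo] --> f_inf],
        exists k p : R, [/\ 0 < k, 2 * k + 3 < p,
          a s / s `^ k @[s --> +oo] --> a_inf &
          f s / s `^ p @[s --> +oo] --> f_inf],
        exists gamma beta : R, [/\ 0 < gamma, 2 * gamma < beta,
          a s / expR (2 * gamma * s) @[s --> +oo] --> a_inf &
          f s / expR (2 * beta * s) @[s --> +oo] --> f_inf] |
        (exists gamma beta : R, [/\ 0 < gamma, 0 < beta,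
          a s / (ln s) `^ (2 * gamma) @[s --> +oo] --> a_inf &
          f s / expR (2 * beta * s) @[s --> +oo] --> f_inf]) \/
        (exists gamma p : R, [/\ 0 < gamma, 3 < p,
          a s / (ln s) `^ (2 * gamma) @[s --> +oo] --> a_inf &
          f s / s `^ p @[s --> +oo] --> f_inf])] ->
  growth_profile a f /\
  \forall s0 \near +oo, forall s, s0 <= s -> 81 / 100 * a s0 <= a s.
Proof.
move=> a0 f0.
have pow_mono k : 0 < k -> \forall s0 \near +oo,
    0 < (s0 : R) `^ k /\ forall s, s0 <= s -> s0 `^ k <= s `^ k.
  move=> k0; near=> s0.
  have s0_gt0 : 0 < s0 by near: s0; exact: nbhs_pinfty_gt.
  split=> [|s s0s]; first exact: powR_gt0.
  by apply: ge0_ler_powR; rewrite ?nnegrE; lra.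
have ln_mono k : 0 < k -> \forall s0 \near +oo,
    0 < ln (s0 : R) `^ k /\ forall s, s0 <= s -> ln s0 `^ k <= ln s `^ k.
  move=> k0; near=> s0.
  have s1 : 1 < s0 by near: s0; exact: nbhs_pinfty_gt.
  split=> [|s s0s]; first exact/powR_gt0/ln_gt0.
  have ss1 : 1 < s by exact: lt_le_trans s0s.
  by apply: ge0_ler_powR; rewrite ?nnegrE ?ler_ln ?posrE ?ln_ge0 //; lra.
have exp_mono k : 0 < k -> \forall s0 \near +oo,
    0 < expR (k * s0 : R) /\ forall s, s0 <= s -> expR (k * s0) <= expR (k * s).
  move=> k0; near=> s0; split=> [|s s0s]; first exact: expR_gt0.
  by rewrite ler_expR ler_pM2l.
case=> [[k [b [k0 b0 al fl]]]|[k [p [k0 p0 al fl]]]|[g [b [g0 b0 al fl]]]|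
        [[g [b [g0 b0 al fl]]]|[g [p [g0 p0 al fl]]]]].
- split; last exact: almost_nondecreasing a0 al (pow_mono _ k0).
  have aub : \forall s \near +oo, a s <= 2 * a_inf * s `^ k.
    by apply: near_le_of_ratio_cvg => //; apply: filterS (pow_mono _ k0) => s [].
  (* The power [s^k] is dominated by [exp (b s / 2)]: any rate strictly between 0 and [b] would do,
     and [b / 4] is half of the chosen one. *)
  apply: (@exponential_profile _ _ f_inf (2 * a_inf * (b / 2 / k) `^ (- k)) (b / 4) b) => //.
  + by rewrite !mulr_gt0 ?powR_gt0// !divr_gt0.
  + by lra.
  + by lra.
  near=> s; have s0 : 0 < s by near: s; exact: nbhs_pinfty_gt.
  have : a s <= 2 * a_inf * s `^ k by near: s.
  move=> /le_trans; apply; rewrite -[leRHS]mulrA ler_pM2l ?mulr_gt0//.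
  have -> : 2 * (b / 4) * s = b / 2 * s by field.
  by apply: powR_le_expR => //; rewrite divr_gt0.
- split; last exact: almost_nondecreasing a0 al (pow_mono _ k0).
  have aub : \forall s \near +oo, a s <= 2 * a_inf * s `^ k.
    by apply: near_le_of_ratio_cvg => //; apply: filterS (pow_mono _ k0) => s [].
  apply: (@power_profile _ _ f_inf (2 * a_inf) (k / 2) p) => //.
  + by rewrite mulr_gt0.
  + by rewrite divr_ge0// ltW.
  + by lra.
  by have -> : 2 * (k / 2) = k by field.
- have g20 : 0 < 2 * g by lra.
  split; last exact: almost_nondecreasing a0 al (exp_mono _ g20).
  apply: (@exponential_profile _ _ f_inf (2 * a_inf) g b) => //.
  + by rewrite mulr_gt0.
  + by rewrite ltW.
  by apply: near_le_of_ratio_cvg => //; apply: filterS (exp_mono _ g20) => s [].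
- have g20 : 0 < 2 * g by lra.
  split; last exact: almost_nondecreasing a0 al (ln_mono _ g20).
  have aub : \forall s \near +oo, a s <= 2 * a_inf * ln s `^ (2 * g).
    by apply: near_le_of_ratio_cvg => //; apply: filterS (ln_mono _ g20) => s [].
  apply: (@exponential_profile _ _ f_inf
    (2 * a_inf * (b / 2 / (2 * g)) `^ (- (2 * g))) (b / 4) b) => //.
  + by rewrite !mulr_gt0 ?powR_gt0// !divr_gt0.
  + by lra.
  + by lra.
  near=> s; have s1 : 1 < s by near: s; exact: nbhs_pinfty_gt.
  have s0 : 0 < s by lra.
  have : a s <= 2 * a_inf * ln s `^ (2 * g) by near: s.
  move=> /le_trans; apply; rewrite -[leRHS]mulrA ler_pM2l ?mulr_gt0//.
  have -> : 2 * (b / 4) * s = b / 2 * s by field.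
  (* Since [ln s <= s], the logarithmic case reduces to the bound for powers. *)
  apply: le_trans (powR_le_expR g20 _ s0); last by rewrite divr_gt0.
  have := ln_sublinear s0; have := ln_ge0 (ltW s1).
  by move=> *; apply: ge0_ler_powR; rewrite ?nnegrE; lra.
- have g20 : 0 < 2 * g by lra.
  split; last exact: almost_nondecreasing a0 al (ln_mono _ g20).
  have aub : \forall s \near +oo, a s <= 2 * a_inf * ln s `^ (2 * g).
    by apply: near_le_of_ratio_cvg => //; apply: filterS (ln_mono _ g20) => s [].
  (* With this exponent [4 e + 3] is the midpoint of [3] and [p], hence below [p]. *)
  pose e := (p - 3) / 8.
  have e0 : 0 < e by rewrite /e; lra.
  apply: (@power_profile _ _ f_inf (2 * a_inf * (2 * e / (2 * g)) `^ (- (2 * g))) e p) => //.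
  + by rewrite !mulr_gt0 ?powR_gt0// divr_gt0// mulr_gt0.
  + by rewrite ltW.
  + by rewrite /e; lra.
  near=> s; have s1 : 1 < s by near: s; exact: nbhs_pinfty_gt.
  have : a s <= 2 * a_inf * ln s `^ (2 * g) by near: s.
  move=> /le_trans; apply; rewrite -[leRHS]mulrA ler_pM2l ?mulr_gt0//.
  by apply: lnX_le_powR => //; rewrite mulr_gt0.
Unshelve. all: by end_near. Qed.

End growth.

(** * The profile [g o eta] and its slope *)

Section one_dimensional_profile.
Variables (R : realType) (a f g eta : R -> R) (nu r : R).
Hypothesis a_C1 : C1 a.
Hypothesis nu_gt0 : 0 < nu.
Hypothesis a_ge_nu : forall s, nu <= a s.
Hypothesis f_cont : continuous f.
Hypothesis g_ode : forall t : R, is_derive t (1 : R) g (1 / Num.sqrt (a (g t))).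
Hypothesis g0 : g 0 = 0.
Hypothesis eta_ode : \forall t \near (0 : R)^'+,
  is_derive t (1 : R) eta (- Num.sqrt (2 * primitive_from r f (g (eta t)))).
Hypothesis eta_lim : eta t @[t --> 0^'+] --> +oo.
Hypothesis prof : growth_profile a f.
Hypothesis a_mono : \forall s0 \near +oo, forall s, s0 <= s ->
  81 / 100 * a s0 <= a s.

Let a_gt0 s : 0 < a s. Proof. exact: lt_le_trans (a_ge_nu s). Qed.

Lemma C1_is_derive (h : R -> R) (s : R) : C1 h -> is_derive (s : R) (1 : R) h (derive1 h s).
Proof. by move=> [dh _]; rewrite derive1E; exact: derivableP. Qed.

Lemma is_derive_sqrt (h : R -> R) (s dh : R) : 0 < h s -> is_derive (s : R) (1 : R) h dh ->
  is_derive (s : R) (1 : R) (fun x => Num.sqrt (h x)) (dh / (2 * Num.sqrt (h s))).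
Proof.
move=> h0 hd; rewrite mulrC.
exact: (@is_derive1_comp _ (@Num.sqrt R) h s _ _ (is_derive1_sqrt h0)).
Qed.

(** While [g] stays in [[0, A]], its slope is at least [1 / M], with [M ^+ 2] the maximum of [a]
    there; it must reach [A] by the time [A * M]. *)
Lemma g_cvgy : g t @[t --> +oo] --> +oo.
Proof.
have g_nd s t : s <= t -> g s <= g t.
  move=> st; apply: (@le_of_derive _ g (fun t => 1 / Num.sqrt (a (g t))) _ _ st) => x _.
  by rewrite divr_ge0 ?sqrtr_ge0.
apply/cvgryPge => A.
suff [T HT] : exists T, A <= g T.
  near=> t; apply: (le_trans HT); apply: g_nd.
  by near: t; apply: nbhs_pinfty_ge; rewrite num_real.
have [A0|A0] := leP A 0; first by exists 0; rewrite g0.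
have ca : {within `[0, A], continuous a}.
  apply: continuous_subspaceT => x.
  exact: is_derive_continuous (C1_is_derive x a_C1).
have [c _ Hc] := EVT_max (ltW A0) ca.
pose M := Num.sqrt (a c).
have M0 : 0 < M by rewrite sqrtr_gt0.
exists (A * M); rewrite leNgt; apply/negP => gA.
have AM0 : 0 <= A * M by rewrite mulr_ge0// ltW.
have : g 0 - M^-1 * 0 <= g (A * M) - M^-1 * (A * M).
  apply: (@le_of_derive _ (fun t => g t - M^-1 * t)
    (fun t => 1 / Num.sqrt (a (g t)) - M^-1)) => // x /andP[x0 xA].
    apply: is_deriveB; rewrite -[X in is_derive _ _ _ X]mulr1.
    by apply: is_derive_cM; exact: is_derive_id.
  rewrite subr_ge0 div1r lef_pV2 ?posrE ?sqrtr_gt0//.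
  apply/ler_wsqrtr/Hc; rewrite in_itv/=; apply/andP; split.
    by rewrite -g0 g_nd.
  by rewrite (le_trans (g_nd _ _ xA))// ltW.
rewrite g0 mulr0 subrr subr_ge0 mulrCA mulVf ?gt_eqF// mulr1.
by rewrite leNgt gA.
Unshelve. all: by end_near. Qed.

Definition profile t := g (eta t).
Definition profile_slope t :=
  Num.sqrt (2 * primitive_from r f (profile t)) / Num.sqrt (a (profile t)).

Lemma profile_cvgy : profile t @[t --> 0^'+] --> +oo.
Proof. exact: (cvg_comp _ _ eta_lim g_cvgy). Qed.

Lemma profile_derive :
  \forall t \near (0 : R)^'+, is_derive (t : R) (1 : R) profile (- profile_slope t).
Proof.
apply: filterS eta_ode => t etat.
have -> : - profile_slope t = 1 / Num.sqrt (a (g (eta t))) *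
  - Num.sqrt (2 * primitive_from r f (g (eta t))).
  by rewrite /profile_slope /profile div1r mulrN mulrC.
exact: (@is_derive1_comp _ g eta).
Qed.

(** The formula for the derivative of the slope [q] amounts to differentiating
    [a(gam) q^2 = 2 F(gam)] along [gam' = - q]. Its term in [a'] is the one that later cancels the
    gradient term of the equation. *)
Lemma profile_facts :
  (\forall t \near (0 : R)^'+,
    [/\ is_derive (t : R) (1 : R) profile (- profile_slope t), 0 < profile_slope t,
       is_derive (t : R) (1 : R) profile_slope
         (profile_slope t ^+ 2 * derive1 a (profile t) / (2 * a (profile t)) -
          f (profile t) / a (profile t)) &
       3 / 4 * (a (profile t) * profile_slope t) <= f (profile t) * t]) /\
  t ^+ 2 * profile_slope t @[t --> 0^'+] --> 0.
Proof.
have F_derive : \forall s \near +oo,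
    is_derive (s : R) (1 : R) (primitive_from r f) (f s).
  near=> s; apply: primitive_from_derive => //.
  by near: s; apply: nbhs_pinfty_gt; rewrite num_real.
have [F0 ft tt] := profile_asymptotics nu_gt0 a_ge_nu a_mono F_derive
  profile_derive profile_cvgy prof.
split; last exact: tt.
have gd := profile_derive.
have gr : \forall t \near (0 : R)^'+, r < profile t.
  exact: (cvgry_gt profile_cvgy r).
near=> t.
have Ft : 0 < primitive_from r f (profile t) by near: t.
have dg : is_derive (t : R) (1 : R) profile (- profile_slope t) by near: t.
have rg : r < profile t by near: t.
have slope_gt0 : 0 < profile_slope t.
  by rewrite divr_gt0// sqrtr_gt0// mulr_gt0.
split => //; last by near: t.
have dF := is_derive1_comp (primitive_from_derive f_cont rg) dg.
have da := is_derive1_comp (C1_is_derive (profile t) a_C1) dg.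
have F20 : 0 < 2 * primitive_from r f (profile t) by rewrite mulr_gt0.
have dFs := @is_derive_sqrt (fun t => 2 * primitive_from r f (profile t)) t _ F20
  (is_derive_cM 2 dF).
have das := @is_derive_sqrt (fun t => a (profile t)) t _ (a_gt0 _) da.
have A0 : 0 < Num.sqrt (a (profile t)) by rewrite sqrtr_gt0.
have dasV := @is_deriveV _ (fun x => Num.sqrt (a (profile x))) t _ 1 (lt0r_neq0 A0) das.
have dslope : is_derive t (1 : R) profile_slope _ := @is_deriveM _ _ _ _ t 1 _ _ dFs dasV.
refine (is_derive_eq dslope _).
rewrite -[RHS]/(_ - _) /GRing.scale/=.
set A := Num.sqrt _ in A0 *; set B := Num.sqrt _.
have B0 : 0 < B by rewrite sqrtr_gt0.
have -> : a (profile t) = A ^+ 2 by rewrite sqr_sqrtr// ltW.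
have -> : profile_slope t = B / A by [].
by field; rewrite !gt_eqF.
Unshelve. all: by end_near. Qed.

End one_dimensional_profile.

(** * The equation at a touching point *)

Section touching.
Variables (R : realType) (N : nat).
Implicit Types (u : 'rV[R]_N -> R) (x c v : 'rV[R]_N).

Definition sqdist x c : R := \sum_(i < N) (x 0 i - c 0 i) ^+ 2.

Lemma sqdist_line x c i (h : R) :
  sqdist (h *: delta_mx 0 i + x) c =
  sqdist x c + 2 * (x 0 i - c 0 i) * h + h ^+ 2.
Proof.
rewrite /sqdist (bigD1 i)//= [in RHS](bigD1 i)//=.
rewrite (eq_bigr (fun j => (x 0 j - c 0 j) ^+ 2)); last first.
  by move=> j ji; rewrite !mxE eqxx (negbTE ji) mulr0 add0r.
by rewrite !mxE !eqxx /=; ring.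
Qed.

Lemma is_derive_line u x v (h d : R) : is_derive (h *: v + x) v u d ->
  is_derive h (1 : R) (fun k => u (k *: v + x)) d.
Proof.
have E : (fun k : R => k^-1 *: (((fun k => u (k *: v + x)) \o shift h) (k *: (1 : R)) -
    u (h *: v + x))) =
  (fun k => k^-1 *: ((u \o shift (h *: v + x)) (k *: v) - u (h *: v + x))).
  by apply/funext => k /=; rewrite [k *: (1 : R)]mulr1 scalerDl addrA.
by move=> [du dE]; split; [rewrite /derivable E|rewrite -dE /derive E].
Qed.

Lemma is_derive_lineP u x v (d : R) :
  is_derive (0 : R) (1 : R) (fun k : R => u (k *: v + x)) d -> is_derive x v u d.
Proof.
have E : (fun k : R => k^-1 *: (((fun k => u (k *: v + x)) \o shift (0 : R)) (k *: (1 : R)) -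
    u ((0 : R) *: v + x))) =
  (fun k => k^-1 *: ((u \o shift x) (k *: v) - u x)).
  by apply/funext => k /=; rewrite addr0 scale0r add0r [k *: (1 : R)]mulr1.
by move=> [du dE]; split; [rewrite /derivable -E|rewrite -dE /derive -E].
Qed.

(** The chain rule is applied on the line through [x] along [v], so that only directional
    derivatives of [u] enter, as supplied by [C2_on]. *)
Lemma is_derive_comp_dir (b : R -> R) u x v (d du : R) :
  is_derive x v u du -> is_derive (u x) (1 : R) b d ->
  is_derive x v (fun y => b (u y)) (d * du).
Proof.
move=> ux bux; apply: is_derive_lineP.
apply: (@is_derive1_comp _ b (fun k => u (k *: v + x))).
  by rewrite scale0r add0r.
by apply: is_derive_line; rewrite scale0r add0r.
Qed.

Lemma near_line (P : set 'rV[R]_N) x v : (\forall y \near x, P y) ->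
  \forall h \near (0 : R), P (h *: v + x).
Proof.
move=> Px.
have : (h *: v + x) @[h --> (0 : R)] --> x.
  rewrite -[X in _ --> X]add0r -(scale0r v); apply: cvgD; last exact: cvg_cst.
  exact: (@scalel_continuous R _ v (0 : R)).
exact.
Qed.

Lemma sqr_enorm x : enorm x ^+ 2 = \sum_(i < N) x 0 i ^+ 2.
Proof. by rewrite sqr_sqrtr// sumr_ge0// => i _; rewrite sqr_ge0. Qed.

Variables (Omega : set 'rV[R]_N) (u : 'rV[R]_N -> R).
Hypothesis Omega_open : open Omega.
Hypothesis u_C2 : C2_on Omega u.

Lemma divergence_expand (a : R -> R) x : C1 a -> Omega x ->
  divergence (fun y => a (u y) *: grad u y) x =
    a (u x) * (\sum_(i < N) partial i (partial i u) x) +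
    derive1 a (u x) * enorm (grad u x) ^+ 2.
Proof.
move=> aC1 Ox; rewrite sqr_enorm !mulr_sumr -big_split/=; apply: eq_bigr => i _.
have [_ /(_ i)[dui _ /(_ i)[dduj _]]] := u_C2 Ox.
have -> : (fun y => (a (u y) *: grad u y) 0 i) = (fun y => a (u y) * partial i u y).
  by apply/funext => y; rewrite !mxE.
have d1 := is_derive_comp_dir (derivableP dui) (C1_is_derive (u x) aC1).
have [_ d] := @is_deriveM _ _ _ _ _ _ _ _ d1 (derivableP dduj).
by rewrite /partial d /GRing.scale/= !mxE /partial; ring.
Qed.

Variables (c x : 'rV[R]_N) (W dW : R -> R) (d2W e : R).
Hypothesis Ox : Omega x.
Let s := sqdist x c.
Hypothesis W_derive : \forall t \near s, is_derive (t : R) (1 : R) W (dW t).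
Hypothesis dW_derive : is_derive (s : R) (1 : R) dW d2W.
Hypothesis e_neq0 : e != 0.
Hypothesis uW : u x = W s.
Hypothesis u_ge_W : \forall y \near x, 0 <= e * (u y - W (sqdist y c)).

(** The minimum test is applied along each coordinate line, on which the squared distance to [c] is
    a quadratic polynomial. The factor [e] treats contact from below ([e = 1]) and from above
    ([e = -1]) at once. *)
Lemma touching_derivatives i :
  partial i u x = 2 * (x 0 i - c 0 i) * dW s /\
  0 <= e * (partial i (partial i u) x -
            (4 * (x 0 i - c 0 i) ^+ 2 * d2W + 2 * dW s)).
Proof.
pose xi := x 0 i - c 0 i.
pose v : 'rV[R]_N := delta_mx 0 i.
pose p (h : R) := s + 2 * xi * h + h ^+ 2.
have dp (h : R) : is_derive (h : R) (1 : R) p (2 * xi + 2 * h).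
  have d1 : is_derive (h : R) (1 : R) (fun h => 2 * xi * h) (2 * xi).
    rewrite -[X in is_derive _ _ _ X]mulr1.
    by apply: is_derive_cM; exact: is_derive_id.
  have d2 : is_derive (h : R) (1 : R) (fun h => h ^+ 2) (2 * h).
    have d0 : is_derive (h : R) (1 : R) (fun h => h ^+ 2) (h *: (1 : R) + h *: (1 : R)).
      by apply: (@is_deriveM _ _ id id); exact: is_derive_id.
    by refine (is_derive_eq d0 _); rewrite /GRing.scale/=; ring.
  have d3 : is_derive (h : R) (1 : R) (fun h => s + 2 * xi * h) (0 + 2 * xi).
    exact: is_deriveD.
  rewrite -[X in is_derive _ _ _ (X + _)]add0r.
  exact: (@is_deriveD _ _ _ (fun h => s + 2 * xi * h)).
have pE (h : R) : sqdist (h *: v + x) c = p h by rewrite sqdist_line.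
have p0 : p 0 = s by rewrite /p mulr0 expr0n addr0 addr0.
have pc : p h @[h --> (0 : R)] --> s.
  by rewrite -p0; exact: (is_derive_continuous (dp 0)).
have nO : \forall h \near (0 : R), Omega (h *: v + x).
  by apply: near_line; exact: open_nbhs_nbhs.
have nW : \forall h \near (0 : R), is_derive (p h) (1 : R) W (dW (p h)).
  exact: (pc _ W_derive).
have nu := @near_line _ _ v u_ge_W.
have [|||A B] := @derive_at_local_min R
  (fun h => e * (u (h *: v + x) - W (p h)))
  (fun h => e * (partial i u (h *: v + x) - dW (p h) * (2 * xi + 2 * h)))
  (e * (partial i (partial i u) x - (4 * xi ^+ 2 * d2W + 2 * dW s))).
- near=> h; apply: is_derive_cM.
  have Oh : Omega (h *: v + x) by near: h.
  have Wh : is_derive (p h) (1 : R) W (dW (p h)) by near: h.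
  have [_ /(_ i)[/derivableP du _ _]] := u_C2 Oh.
  have d1 := is_derive_line du.
  have d2 := @is_derive1_comp _ W p h _ _ Wh (dp h).
  exact: (@is_deriveB _ _ _ _ _ _ _ _ _ d1 d2).
- apply: is_derive_cM.
  have [_ /(_ i)[_ _ /(_ i)[/derivableP du _]]] := u_C2 Ox.
  have d1 : is_derive (0 : R) (1 : R) (fun h => partial i u (h *: v + x))
      (partial i (partial i u) x).
    by apply: is_derive_line; rewrite scale0r add0r.
  have d2 : is_derive (0 : R) (1 : R) (dW \o p) (d2W * (2 * xi + 2 * 0)).
    by apply: is_derive1_comp; rewrite p0.
  have d3 : is_derive (0 : R) (1 : R) (fun h => 2 * xi + 2 * h) 2.
    rewrite -[X in is_derive _ _ _ X]add0r.
    apply: is_deriveD; rewrite -[X in is_derive _ _ _ X]mulr1.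
    by apply: is_derive_cM; exact: is_derive_id.
  have d4 := @is_deriveM _ _ _ _ _ _ _ _ d2 d3.
  have d5 := @is_deriveB _ _ _ _ _ _ _ _ _ d1 d4.
  refine (is_derive_eq d5 _).
  by rewrite /GRing.scale/= p0; ring.
- near=> h.
  have : 0 <= e * (u (h *: v + x) - W (sqdist (h *: v + x) c)) by near: h.
  by rewrite pE p0 scale0r add0r uW subrr mulr0.
split => //; move/eqP: A.
rewrite mulf_eq0 (negbTE e_neq0)/= subr_eq0 p0 scale0r add0r => /eqP ->.
by rewrite /xi; ring.
Unshelve. all: by end_near. Qed.

(** At the contact point the gradients agree, so the equation turns the inequality between the
    Laplacians into one for [f]. The Laplacian of [W (|x - c|^2)] is [4 s W'' + 2 N W'] and its
    squared gradient is [4 s W'^2]. *)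
Lemma touching_equation (a f : R -> R) : C1 a ->
  (forall x, Omega x -> divergence (fun y => a (u y) *: grad u y) x =
       derive1 a (u x) / 2 * enorm (grad u x) ^+ 2 + f (u x)) ->
  0 < a (u x) ->
  0 <= e * (f (u x) - (a (u x) * (4 * s * d2W + 2 * N%:R * dW s) +
                       2 * derive1 a (u x) * s * dW s ^+ 2)).
Proof.
move=> aC1 u_eq a0; have := u_eq x Ox; rewrite (divergence_expand aC1 Ox).
have -> : enorm (grad u x) ^+ 2 = 4 * s * dW s ^+ 2.
  rewrite sqr_enorm {2}/s /sqdist mulr_sumr mulr_suml; apply: eq_bigr => i _.
  by rewrite mxE; have [-> _] := touching_derivatives i; ring.
set L := \sum_(i < N) _ => E.
have eL : 0 <= e * (L - (4 * s * d2W + 2 * N%:R * dW s)).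
  have -> : e * (L - (4 * s * d2W + 2 * N%:R * dW s)) =
     \sum_(i < N) e * (partial i (partial i u) x -
            (4 * (x 0 i - c 0 i) ^+ 2 * d2W + 2 * dW s)).
    rewrite -mulr_sumr sumrB big_split/= -mulr_suml -mulr_sumr.
    by rewrite sumr_const card_ord -mulr_natr /L /s /sqdist; ring.
  by apply: sumr_ge0 => i _; have [] := touching_derivatives i.
have -> : f (u x) = a (u x) * L + derive1 a (u x) * (2 * s * dW s ^+ 2).
  by move: E; set D := derive1 a _; lra.
have -> : e * (a (u x) * L + derive1 a (u x) * (2 * s * dW s ^+ 2) -
    (a (u x) * (4 * s * d2W + 2 * N%:R * dW s) + 2 * derive1 a (u x) * s * dW s ^+ 2)) =
  a (u x) * (e * (L - (4 * s * d2W + 2 * N%:R * dW s))) by ring.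
by rewrite mulr_ge0// ltW.
Qed.

End touching.

(** * Inverse of the profile *)

Section inverse_profile.
Variables (R : realType) (gam q : R -> R) (tau z0 : R).
Hypothesis gam_derive : forall t, 0 < t < tau ->
  is_derive (t : R) (1 : R) gam (- q t) /\ 0 < q t.
Hypothesis gam_cvgy : gam t @[t --> 0^'+] --> +oo.
Hypothesis z0_gt0 : 0 < z0.
Hypothesis z0_lt : z0 < tau.

Lemma profile_decreasing s t : 0 < s -> s < t -> t < tau -> gam t < gam s.
Proof.
move=> s0 st ttau.
have H x : s <= x <= t -> 0 < x < tau.
  by move=> /andP[sx xt]; rewrite (lt_le_trans s0 sx) (le_lt_trans xt).
have [c cst e] : exists2 c, c \in `]s, t[%R & gam t - gam s = - q c * (t - s).
  apply: (@MVT R gam (fun x => - q x) s t st) => [x|].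
    rewrite in_itv/= => /andP[sx xt].
    by have [|//] := gam_derive (t := x); apply: H; rewrite ltW//= ltW.
  apply: derivable_within_continuous => x; rewrite in_itv/= => /H/gam_derive[].
  by case.
move: cst; rewrite in_itv/= => /andP[sc ct].
have [_ q0] : is_derive c (1 : R) gam (- q c) /\ 0 < q c.
  by apply/gam_derive/H; rewrite !ltW.
by rewrite -subr_lt0 e mulNr oppr_lt0 mulr_gt0// subr_gt0.
Qed.

Lemma profile_nonincreasing s t : 0 < s -> s <= t -> t < tau -> gam t <= gam s.
Proof.
move=> s0; rewrite le_eqVlt => /predU1P[->//|st] ttau.
exact/ltW/profile_decreasing.
Qed.

Lemma profile_increment_le s t (M : R) : 0 < s -> s <= t -> t < tau ->
  (forall x, s <= x <= t -> q x <= M) -> `|gam s - gam t| <= M * (t - s).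
Proof.
move=> s0 st ttau qM.
rewrite ger0_norm ?subr_ge0; last exact: profile_nonincreasing.
suff : gam s + M * s <= gam t + M * t by lra.
apply: (@le_of_derive _ (fun x => gam x + M * x) (fun x => - q x + M)) => // x sxt.
  have [|gx _] := gam_derive (t := x).
    by case/andP: sxt => sx xt; rewrite (lt_le_trans s0 sx) (le_lt_trans xt).
  apply: is_deriveD; rewrite -[X in is_derive _ _ _ X]mulr1.
  by apply: is_derive_cM; exact: is_derive_id.
by have := qM _ sxt; lra.
Qed.

(** Extending the inverse by the constant [z0] makes [Z o u] continuous on all of the domain, also
    where [u] is too small to be a value of [gam] on []0, z0[]. Maxima can then be taken before
    knowing that [u] is large at them. *)
Lemma profile_inverse : exists Z : R -> R, [/\
  forall s, gam z0 < s -> 0 < Z s < z0 /\ gam (Z s) = s,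
  forall s, s <= gam z0 -> Z s = z0 & continuous Z].
Proof.
have ex s : exists t, (gam z0 < s -> 0 < t < z0 /\ gam t = s) /\
    (s <= gam z0 -> t = z0).
  have [sz|zs] := leP s (gam z0); first by exists z0; split.
  have gs : \forall t \near (0 : R)^'+, s < gam t by exact: (cvgry_gt gam_cvgy s).
  have [t1 [t10 t1z st1]] : exists t, [/\ 0 < t, t < z0 & s < gam t].
    near (0 : R)^'+ => t; exists t; split; near: t.
    - exact: nbhs_right_gt.
    - exact: nbhs_right_lt.
    - exact: gs.
  have cg : {within `[t1, z0], continuous gam}.
    apply: derivable_within_continuous => x; rewrite in_itv/= => /andP[tx xz].
    have [|[]//] := gam_derive (t := x).
    by rewrite (lt_le_trans t10 tx) (le_lt_trans xz).
  have [|t] := @IVT R gam t1 z0 s (ltW t1z) cg.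
    by rewrite ge_min le_max (ltW zs) orbT (ltW st1).
  rewrite in_itv/= => /andP[t1t tz] gts; exists t; split => // _; split => //.
  rewrite (lt_le_trans t10 t1t) lt_neqAle tz andbT.
  by apply/negP => /eqP tz0; rewrite -gts tz0 ltxx in zs.
have [Z HZ] := choice ex.
have Zin s : gam z0 < s -> 0 < Z s < z0 /\ gam (Z s) = s by have [] := HZ s.
have Zout s : s <= gam z0 -> Z s = z0 by have [] := HZ s.
have Z_gt0 s : 0 < Z s.
  by have [/Zout ->//|/Zin[/andP[]]] := leP s (gam z0).
have Z_le s : Z s <= z0.
  by have [/Zout ->//|/Zin[/andP[_ /ltW]]] := leP s (gam z0).
have Zlt s t : 0 < t <= z0 -> gam t < s -> Z s < t.
  move=> /andP[t0 tz] ts.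
  have /Zin[_ E] : gam z0 < s.
    by apply: le_lt_trans ts; apply: profile_nonincreasing.
  rewrite ltNge; apply/negP => tZ.
  have := profile_nonincreasing t0 tZ (le_lt_trans (Z_le s) z0_lt).
  by rewrite E leNgt ts.
have Zgt s t : 0 < t < z0 -> s < gam t -> t < Z s.
  move=> /andP[t0 tz] ts.
  have [/Zout ->//|/Zin[_ E]] := leP s (gam z0).
  rewrite ltNge; apply/negP => Zt.
  have := profile_nonincreasing (Z_gt0 s) Zt (lt_trans tz z0_lt).
  by rewrite E leNgt ts.
exists Z; split => // s.
apply/cvgrPdist_lt => e e0.
have lo : \forall x \near s, Z s - e < Z x.
  have [le0|gt0] := leP (Z s - e) 0.
    by near=> x; exact: le_lt_trans le0 (Z_gt0 x).
  have h : gam (Z s) < gam (Z s - e).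
    by apply: profile_decreasing; rewrite ?gtrBl// (le_lt_trans (Z_le s)).
  have hs : s < gam (Z s - e).
    apply: le_lt_trans h; have [sz|/Zin[_ ->]//] := leP s (gam z0).
    by rewrite (Zout _ sz).
  near=> x; apply: Zgt; last by near: x; exact: lt_nbhsl.
  by rewrite gt0 ltrBlDr (le_lt_trans (Z_le s))// ltrDl.
have hi : \forall x \near s, Z x < Z s + e.
  have [le|ez] := ltP z0 (Z s + e).
    by near=> x; exact: le_lt_trans (Z_le x) le.
  have /Zin[_ Es] : gam z0 < s.
    rewrite ltNge; apply/negP => /Zout Zs.
    by move: ez; rewrite Zs gerDl leNgt e0.
  have hs : gam (Z s + e) < s.
    rewrite -[ltRHS]Es.
    by apply: profile_decreasing; rewrite ?ltrDl// (le_lt_trans ez).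
  near=> x; apply: Zlt; last by near: x; exact: lt_nbhsr.
  by rewrite ez andbT addr_gt0.
near=> x.
have xlo : Z s - e < Z x by near: x.
have xhi : Z x < Z s + e by near: x.
by rewrite ltr_norml; apply/andP; split; lra.
Unshelve. all: by end_near. Qed.

End inverse_profile.

(** * Continuity and compactness for the Euclidean distance *)

Section euclid_topology.
Variables (R : realType) (N : nat).
Implicit Types (x c : 'rV[R]_N).

Lemma sqdist_continuous c : continuous (fun x => sqdist x c).
Proof.
rewrite /sqdist; elim: (index_enum _) => [|i r IH].
  have -> : (fun x : 'rV[R]_N => \sum_(i <- [::]) (x 0 i - c 0 i) ^+ 2) = cst 0.
    by apply/funext => y; rewrite big_nil.
  exact: cst_continuous.
have -> : (fun x : 'rV[R]_N => \sum_(i <- i :: r) (x 0 i - c 0 i) ^+ 2) =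
    (fun x => (x 0 i - c 0 i) ^+ 2 + \sum_(i <- r) (x 0 i - c 0 i) ^+ 2).
  by apply/funext => y; rewrite big_cons.
move=> x; apply: (@continuousD _ _ _ (fun x : 'rV[R]_N => (x 0 i - c 0 i) ^+ 2)); last exact: IH.
apply: (@continuous_comp _ _ _ (fun x : 'rV[R]_N => x 0 i - c 0 i)
  (fun t : R => t ^+ 2)); last exact: exprn_continuous.
by apply: continuousB; [exact: coord_continuous|exact: cst_continuous].
Qed.

Lemma norm_coord_le x (M : R) : 0 <= M -> (forall i, `|x 0 i| <= M) -> `|x| <= M.
Proof.
move=> M0 H; rewrite [leLHS]/Num.norm/= mx_normrE; apply: bigmax_le => // -[i j] _ /=.
by rewrite (ord1 i).
Qed.

Lemma sqdist_ball_compact c (rho : R) : compact [set x | sqdist x c <= rho].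
Proof.
apply: bounded_closed_compact.
  (* Each coordinate of [x - c] has square at most [|rho|], hence absolute value at most
     [1 + |rho|]. *)
  exists (`|c| + (1 + `|rho|)); split; first exact: num_real.
  move=> M MM x /= xc; apply: ltW; apply: le_lt_trans MM.
  rewrite -{1}[x](subrK c) addrC (le_trans (ler_normD _ _))// lerD2l.
  apply: norm_coord_le; first by rewrite addr_ge0.
  move=> i; rewrite !mxE.
  have : (x 0 i - c 0 i) ^+ 2 <= rho.
    apply: le_trans xc; rewrite /sqdist (bigD1 i)//= lerDl.
    by apply: sumr_ge0 => j _; rewrite sqr_ge0.
  set t := x 0 i - c 0 i => H.
  have h1 : `|t| ^+ 2 <= `|rho| by rewrite real_normK ?num_real// (le_trans H)// ler_norm.
  have := normr_ge0 t; have := normr_ge0 rho; move: h1.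
  by set p := `|t|; set z := `|rho|; nra.
have -> : [set x | sqdist x c <= rho] = (fun x => sqdist x c) @^-1` [set t | t <= rho] by [].
apply: closed_comp => [x _|]; first exact: sqdist_continuous.
exact: closed_le.
Qed.

End euclid_topology.

(** * Comparison in tangent balls *)

Section barriers.
Variables (R : realType) (N : nat) (Omega : set 'rV[R]_N) (u : 'rV[R]_N -> R).
Variables (a f gam q Z : R -> R) (tau z0 : R).
Hypothesis Omega_open : open Omega.
Hypothesis u_C2 : C2_on Omega u.
Hypothesis a_C1 : C1 a.
Hypothesis a_gt0 : forall s, 0 < a s.
Hypothesis u_eq : forall x, Omega x ->
  divergence (fun y => a (u y) *: grad u y) x =
    derive1 a (u x) / 2 * enorm (grad u x) ^+ 2 + f (u x).
Hypothesis gam_derive : forall t, 0 < t < tau ->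
  is_derive (t : R) (1 : R) gam (- q t) /\ 0 < q t.
Hypothesis q_derive : forall t, 0 < t < tau -> is_derive (t : R) (1 : R) q
  (q t ^+ 2 * derive1 a (gam t) / (2 * a (gam t)) - f (gam t) / a (gam t)).
Hypothesis gam_f : forall t, 0 < t < tau ->
  3 / 4 * (a (gam t) * q t) <= f (gam t) * t.
Hypothesis z0_gt0 : 0 < z0.
Hypothesis z0_lt : z0 < tau.
Hypothesis Z_in : forall s, gam z0 < s -> 0 < Z s < z0 /\ gam (Z s) = s.
Hypothesis Z_out : forall s, s <= gam z0 -> Z s = z0.
Hypothesis Z_cont : continuous Z.

(** Contact is tested with [W = gam o w]; inserting the formula for [q'] removes [a'] altogether.
    What remains is the equation for [z] at the barrier: [4 s dw^2] is its squared gradient and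
    [4 s d2w + 2 N dw] its Laplacian. *)
Lemma touching_profile (c x : 'rV[R]_N) (w dw : R -> R) (d2w e : R) :
  Omega x -> e != 0 ->
  (forall t, is_derive (t : R) (1 : R) w (dw t)) ->
  (forall t, is_derive (t : R) (1 : R) dw d2w) ->
  let s := sqdist x c in let t := w s in
  0 < t < tau -> u x = gam t ->
  (\forall y \near x, 0 <= e * (u y - gam (w (sqdist y c)))) ->
  0 <= e * (f (gam t) * (1 - 4 * s * dw s ^+ 2) +
            a (gam t) * q t * (4 * s * d2w + 2 * N%:R * dw s)).
Proof.
move=> Ox e0 dW ddW s t tt ux uW.
have [gd q0] := gam_derive tt.
pose D := q t ^+ 2 * derive1 a (gam t) / (2 * a (gam t)) - f (gam t) / a (gam t).
have wc : w y @[y --> s] --> t by exact: (is_derive_continuous (dW s)).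
have nt : \forall y \near s, 0 < w y < tau.
  have /andP[t0 ttau] := tt.
  near=> y; apply/andP; split; near: y.
    exact: (cvgr_gt t wc).
  exact: (cvgr_lt t wc).
have nW : \forall y \near s,
    is_derive (y : R) (1 : R) (fun y => gam (w y)) (- q (w y) * dw y).
  near=> y; have ty : 0 < w y < tau by near: y.
  have [gy _] := gam_derive ty.
  exact: (@is_derive1_comp _ gam w).
have dW2 : is_derive (s : R) (1 : R) (fun y => - q (w y) * dw y)
    (- q t * d2w - D * dw s ^+ 2).
  have d1 : is_derive (s : R) (1 : R) (q \o w) (D * dw s).
    exact: (@is_derive1_comp _ q w s _ _ (q_derive tt) (dW s)).
  have d2 := @is_deriveN _ _ _ _ _ _ _ d1.
  have d3 := @is_deriveM _ _ _ _ _ _ _ _ d2 (ddW s).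
  refine (is_derive_eq d3 _).
  by rewrite /GRing.scale/= opprfctE /= -/t; ring.
have := touching_equation Omega_open u_C2 Ox nW dW2 e0 ux uW a_C1 u_eq (a_gt0 _).
rewrite ux -/s -/t /D; set A := derive1 _ _.
move=> H; apply: le_trans H _; rewrite le_eqVlt; apply/orP; left; apply/eqP.
by field; rewrite gt_eqF.
Unshelve. all: by end_near. Qed.

Let Z_gt0 s : 0 < Z s.
Proof. by have [/Z_out ->//|/Z_in[/andP[]]] := leP s (gam z0). Qed.

Let Z_le s : Z s <= z0.
Proof. by have [/Z_out ->//|/Z_in[/andP[_ /ltW]]] := leP s (gam z0). Qed.

Let gam_anti s t : 0 < s -> s <= t -> t < tau -> gam t <= gam s.
Proof. exact: (profile_nonincreasing gam_derive). Qed.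

(** This direction of the inversion survives the truncation: where [Z s = z0] by default, [s] is
    already at most [gam z0]. *)
Let le_gam_Z s t : 0 < t -> t <= Z s -> s <= gam t.
Proof.
move=> t0 tZ; have [sz|/Z_in[_ E]] := leP s (gam z0).
  apply: (le_trans sz); apply: gam_anti => //.
  exact: le_trans tZ (Z_le s).
by rewrite -E; apply: gam_anti => //; exact: le_lt_trans (Z_le s) z0_lt.
Qed.

Let u_cont x : Omega x -> {for x, continuous u}.
Proof. by move=> Ox; have [] := u_C2 Ox. Qed.


(** If the bound fails, [w - Z o u] has a positive maximum on the closed ball. It is not on the
    sphere, where [w = 0 < Z], so [gam] of the lowered barrier touches [u] from above there, and the
    equation is contradicted. *)
Lemma inner_barrier (c : 'rV[R]_N) (rho K : R) : 0 < rho ->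
  (forall x, sqdist x c <= rho ^+ 2 -> Omega x) ->
  N%:R / rho <= K -> 1 < 4 * K * z0 ->
  forall x s, 0 < s -> sqdist x c = rho ^+ 2 - 2 * rho * s ->
  s - K * s ^+ 2 <= Z (u x).
Proof.
move=> rho0 BO NK Kz x1 s1 s10 x1E.
have [//|Zs1] := leP (s1 - K * s1 ^+ 2) (Z (u x1)); exfalso.
have K0 : 0 < K by rewrite -(pmulr_lgt0 _ z0_gt0); lra.
have x1B : sqdist x1 c < rho ^+ 2 by rewrite x1E gtrBl !mulr_gt0.
pose s t := (rho ^+ 2 - t) / (2 * rho).
pose w t := s t - K * s t ^+ 2.
have s_der t : is_derive (t : R) (1 : R) s (- (2 * rho)^-1).
  have d : is_derive (t : R) (1 : R) (fun t => (2 * rho)^-1 * (rho ^+ 2 - t))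
      ((2 * rho)^-1 * (0 - 1)).
    by apply: is_derive_cM; apply: is_deriveB.
  have -> : s = (fun t => (2 * rho)^-1 * (rho ^+ 2 - t)).
    by apply/funext => y; rewrite /s mulrC.
  by refine (is_derive_eq d _); ring.
have w_der0 t : is_derive (t : R) (1 : R) w (- (1 - 2 * K * s t) / (2 * rho)).
  have d1 := @is_deriveM _ _ _ _ _ _ _ _ (s_der t) (s_der t).
  have d2 := is_derive_cM K d1.
  have d3 := @is_deriveB _ _ _ _ _ _ _ _ _ (s_der t) d2.
  refine (is_derive_eq d3 _); rewrite /GRing.scale/=.
  by field; rewrite gt_eqF.
have sc (x : 'rV[R]_N) : {for x, continuous (fun x => w (sqdist x c))}.
  apply: (@continuous_comp _ _ _ (fun x => sqdist x c) w).
    exact: sqdist_continuous.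
  exact: is_derive_continuous (w_der0 _).
pose h x := w (sqdist x c) - Z (u x).
have [x xB hmax] : exists2 x, x \in [set x | sqdist x c <= rho ^+ 2] &
    forall y, y \in [set x | sqdist x c <= rho ^+ 2] -> h y <= h x.
apply: compact_EVT_max.
- by exists x1 => /=; exact: ltW.
- exact: sqdist_ball_compact.
- apply: continuous_in_subspaceT => y; rewrite inE/= => yB.
  apply: (@continuousB _ _ _ (fun x => w (sqdist x c)) (fun x => Z (u x))).
    exact: sc.
  apply: (@continuous_comp _ _ _ u Z); last exact: Z_cont.
  exact/u_cont/BO.
rewrite inE/= in xB.
have hx0 : 0 < h x.
  apply: (@lt_le_trans _ _ (h x1)).
    rewrite subr_gt0 /w; have -> // : s (sqdist x1 c) = s1.
    by rewrite /s x1E; field; rewrite gt_eqF.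
  by apply: hmax; rewrite inE/= ltW.
have Ox := BO _ xB.
set S := s (sqdist x c).
have wZ : Z (u x) < S - K * S ^+ 2 by rewrite -subr_gt0.
have Zx0 := Z_gt0 (u x).
have S0 : 0 < S.
  rewrite lt_neqAle; apply/andP; split.
    by apply/negP => /eqP S0; move: wZ Zx0; rewrite -S0; nra.
  by rewrite divr_ge0 ?mulr_ge0 ?subr_ge0// ltW.
have S1 : 0 < 1 - K * S by nra.
(* The barrier never exceeds [1 / (4 K)], which is below [z0]. Hence [Z (u x)] is a true inverse
   value and not the default one. *)
have wz0 : S - K * S ^+ 2 < z0.
  have : 4 * K * (S - K * S ^+ 2) <= 1 by have := sqr_ge0 (1 - 2 * K * S); nra.
  by nra.
have Zz0 : gam z0 < u x.
  rewrite ltNge; apply/negP => /Z_out E.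
  by move: wZ; rewrite E ltNge (ltW wz0).
have [_ gZ] := Z_in Zz0.
have xB' : sqdist x c < rho ^+ 2.
  by move: S0; rewrite /S /s pmulr_lgt0 ?invr_gt0 ?mulr_gt0// subr_gt0.
have near_x : \forall y \near x, 0 <= -1 * (u y - gam (w (sqdist y c) - h x)).
  have n1 : \forall y \near x, sqdist y c < rho ^+ 2.
    have cv : sqdist y c @[y --> x] --> sqdist x c by exact: sqdist_continuous.
    exact: (cvgr_lt _ cv _ xB').
  have n2 : \forall y \near x, h x < w (sqdist y c).
    have cv : w (sqdist y c) @[y --> x] --> w (sqdist x c) by exact: sc.
    apply: (cvgr_gt _ cv).
    by rewrite /h ltrBlDr ltrDl.
  near=> y; rewrite mulN1r opprB subr_ge0.
  have hy : h y <= h x by apply: hmax; rewrite inE/= ltW//; near: y.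
  apply: le_gam_Z; first by rewrite subr_gt0; near: y.
  by rewrite lerBlDl -lerBlDr.
have wE : w (sqdist x c) - h x = Z (u x) by rewrite /h opprB addrC subrK.
have N1 : -1 != 0 :> R by rewrite oppr_eq0 oner_eq0.
have w_der t : is_derive (t : R) (1 : R) (fun t => w t - h x)
    (- (1 - 2 * K * s t) / (2 * rho)).
  have d4 := @is_deriveB _ _ _ _ _ _ _ _ _ (w_der0 t) (is_derive_cst (h x) t 1).
  by refine (is_derive_eq d4 _); rewrite subr0.
have w_der2 t : is_derive (t : R) (1 : R) (fun t => - (1 - 2 * K * s t) / (2 * rho))
    (- (2 * K) / (2 * rho) ^+ 2).
  have d1 := is_derive_cM (2 * K / (2 * rho)) (s_der t).
  have d2 := @is_deriveD _ _ _ _ _ _ _ _ _ (is_derive_cst (- (2 * rho)^-1) t 1) d1.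
  have -> : (fun t => - (1 - 2 * K * s t) / (2 * rho)) =
    cst (- (2 * rho)^-1) + (fun t => 2 * K / (2 * rho) * s t).
    by apply/funext => y; rewrite fctE/=; field; rewrite gt_eqF.
  by refine (is_derive_eq d2 _); field; rewrite gt_eqF.
have tt : 0 < w (sqdist x c) - h x < tau.
  by rewrite wE Zx0 (le_lt_trans (Z_le _)).
have ux : u x = gam (w (sqdist x c) - h x) by rewrite wE gZ.
have := touching_profile Ox N1 w_der w_der2 tt ux near_x.
have [_ q0] := gam_derive tt.
have := gam_f tt.
rewrite wE gZ in q0 *; rewrite -/S.
set F := f _; set A := a _; set Q := q _ in q0 *; set T := Z _ in Zx0 wZ *.
have A0 : 0 < A by exact: a_gt0.
set r2 := sqdist x c.
have r2E : r2 = rho ^+ 2 - 2 * rho * S.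
  by rewrite /S /s -/r2; field; rewrite gt_eqF.
have r20 : 0 <= r2 by apply: sumr_ge0 => i _; rewrite sqr_ge0.
have -> : 4 * r2 * (- (1 - 2 * K * S) / (2 * rho)) ^+ 2 =
   (1 - 2 * S / rho) * (1 - 2 * K * S) ^+ 2.
  by rewrite r2E; field; rewrite gt_eqF.
have -> : 4 * r2 * (- (2 * K) / (2 * rho) ^+ 2) + 2 * N%:R * (- (1 - 2 * K * S) / (2 * rho))
  = - ((1 - 2 * S / rho) * (2 * K) + N%:R / rho * (1 - 2 * K * S)).
  by rewrite r2E; field; rewrite gt_eqF.
set m := 2 * S / rho; set n := N%:R / rho in NK *.
have m0 : 0 <= m by apply: divr_ge0; [apply: mulr_ge0 => //; exact: ltW|exact: ltW].
have n0 : 0 <= n by apply: divr_ge0; [exact: ler0n|exact: ltW].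
have m1 : m <= 1.
  by rewrite /m ler_pdivrMr// mul1r; move: r20; rewrite r2E; nra.
set AQ := A * Q; have AQ0 : 0 < AQ by rewrite mulr_gt0.
move=> hF; rewrite mulN1r oppr_ge0 => H.
have F0 : 0 < F by rewrite -(pmulr_lgt0 _ Zx0); apply: lt_le_trans hF;
  rewrite mulr_gt0//; lra.
clear - F0 hF H wZ K0 S0 NK m0 n0 m1 AQ0.
(* As [1 - (1 - 2 K S)^2 = 4 K w] and [w > T], the first-order term exceeds [4 K F T >= 3 K AQ]. The
   Laplacian costs at most [(2 K + n) AQ], and [n <= K] closes the gap. *)
have h1 : F * (4 * K * (S - K * S ^+ 2)) <= F * (1 - (1 - m) * (1 - 2 * K * S) ^+ 2).
  rewrite ler_pM2l//.
  have : 0 <= m * (1 - 2 * K * S) ^+ 2 by rewrite mulr_ge0// sqr_ge0.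
  lra.
have h2 : F * (4 * K * T) < F * (4 * K * (S - K * S ^+ 2)).
  by rewrite ltr_pM2l// ltr_pM2l// mulr_gt0.
have h3 : 4 * K * (3 / 4 * AQ) <= 4 * K * (F * T) by rewrite ler_pM2l// mulr_gt0.
have h4 : (1 - m) * (2 * K) + n * (1 - 2 * K * S) <= 2 * K + n.
  have : 0 <= m * K by apply: mulr_ge0 => //; exact: ltW.
  have : 0 <= n * (K * S) by apply: mulr_ge0 => //; apply: mulr_ge0; exact: ltW.
  lra.
have h5 : AQ * ((1 - m) * (2 * K) + n * (1 - 2 * K * S)) <= AQ * (3 * K).
  by rewrite ler_pM2l//; lra.
lra.
Unshelve. all: by end_near. Qed.

(** With [P] the inverse of [y + K y^2 / 2], a failure makes [P (Z o u) - s] positive somewhere. The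
    blow-up of [u] keeps its maximum off the boundary of the domain, and the condition on [z0] and
    [s1] keeps it off the outer edge [s = s1]. There [gam] of the barrier shifted in [s] touches [u]
    from below. *)
Lemma outer_barrier (c : 'rV[R]_N) (rho K s1 : R) : 0 < rho -> 0 < s1 ->
  (forall x, Omega x -> rho ^+ 2 <= sqdist x c) ->
  (forall x, Omega x -> sqdist x c <= rho ^+ 2 + 2 * rho * s1 -> gam z0 < u x) ->
  (forall A, exists T, [/\ compact T, T `<=` Omega &
     forall x, Omega x -> ~ T x -> A < u x]) ->
  0 < K -> z0 <= s1 + K / 2 * s1 ^+ 2 -> N%:R / rho * (1 + K * s1) < K / 2 ->
  forall x s, Omega x -> s <= s1 -> sqdist x c = rho ^+ 2 + 2 * rho * s ->
  Z (u x) <= s + K / 2 * s ^+ 2.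
Proof.
move=> rho0 s10 OB Bu uT K0 zs1 NK x0 s0 Ox0 s0s1 x0E.
have [//|Zs0] := leP (Z (u x0)) (s0 + K / 2 * s0 ^+ 2); exfalso.
pose P t := K^-1 * (Num.sqrt (1 + 2 * K * t) - 1).
have PQ t : 0 <= t -> 0 <= P t /\ P t + K / 2 * P t ^+ 2 = t.
  move=> t0; have Kt : 0 <= K * t by rewrite mulr_ge0// ltW.
  have r0 : 0 <= 1 + 2 * K * t by lra.
  have r1 : 1 <= Num.sqrt (1 + 2 * K * t).
    by rewrite -[leLHS]sqrtr1; apply: ler_wsqrtr; lra.
  split; first by rewrite mulr_ge0 ?subr_ge0// invr_ge0 ltW.
  have E : t = (Num.sqrt (1 + 2 * K * t) ^+ 2 - 1) / (2 * K).
    by rewrite sqr_sqrtr//; field; rewrite gt_eqF.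
  rewrite [RHS]E /P; set S := Num.sqrt _.
  by field; rewrite gt_eqF.
have P_le t y : 0 <= t -> 0 <= y -> P t <= y -> t <= y + K / 2 * y ^+ 2.
  move=> t0 y0 Py; have [p0 E] := PQ _ t0; rewrite -[leLHS]E.
  have : P t ^+ 2 <= y ^+ 2 by rewrite ler_pXn2r.
  by rewrite -(ler_pM2l K0); lra.
have P_lt t y : 0 <= t -> 0 <= y -> t < y + K / 2 * y ^+ 2 -> P t < y.
  move=> t0 y0; rewrite !ltNge; apply: contra => yP.
  have [p0 E] := PQ _ t0; rewrite -[leRHS]E.
  have : y ^+ 2 <= P t ^+ 2 by rewrite ler_pXn2r.
  by rewrite -(ler_pM2l K0); lra.
have P_cont : continuous P.
  move=> t.
  have d1 : is_derive (t : R) (1 : R) (fun t => 1 + 2 * K * t) (0 + 2 * K * 1).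
    by apply: is_deriveD; apply: is_derive_cM; exact: is_derive_id.
  pose l (y : R) := K^-1 * (y - 1).
  have d2 (y : R) : is_derive (y : R) (1 : R) l (K^-1 * (1 - 0)).
    by apply: is_derive_cM; apply: is_deriveB.
  apply: (@continuous_comp _ _ _ (fun t => 1 + 2 * K * t) (l \o @Num.sqrt R)).
    exact: is_derive_continuous d1.
  apply: (@continuous_comp _ _ _ (@Num.sqrt R) l); first exact: sqrt_continuous.
  exact: is_derive_continuous (d2 _).
pose s t := (2 * rho)^-1 * (t - rho ^+ 2).
have s_der t : is_derive (t : R) (1 : R) s (2 * rho)^-1.
  have d : is_derive (t : R) (1 : R) s ((2 * rho)^-1 * (1 - 0)).
    by apply: is_derive_cM; apply: is_deriveB.
  by refine (is_derive_eq d _); ring.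
have s_cont (x : 'rV[R]_N) : {for x, continuous (fun x => s (sqdist x c))}.
  apply: (@continuous_comp _ _ _ (fun x => sqdist x c) s).
    exact: sqdist_continuous.
  exact: is_derive_continuous (s_der _).
have sE x : sqdist x c = rho ^+ 2 + 2 * rho * s (sqdist x c).
  by rewrite /s; field; rewrite gt_eqF.
have s_ge0 x : Omega x -> 0 <= s (sqdist x c).
  move=> /OB xB; rewrite mulr_ge0 ?subr_ge0// invr_ge0; lra.
have sx0 : s (sqdist x0 c) = s0 by rewrite /s x0E; field; rewrite gt_eqF.
have s00 : 0 <= s0 by rewrite -sx0; exact: s_ge0.
pose h x := P (Z (u x)) - s (sqdist x c).
have Z_ge0 t : 0 <= Z t by exact/ltW/Z_gt0.
have h0 : 0 < h x0.
  rewrite /h sx0 subr_gt0 ltNge; apply/negP => /(P_le _ _ (Z_ge0 _) s00).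
  by rewrite leNgt Zs0.
have [p0 pE] := PQ _ (Z_ge0 (u x0)).
(* Above this level [Z (u x)] is so small that [P (Z (u x)) < h x0], so points outside [T] cannot
   compete with [x0]. The minimum with [z0] keeps the level in the range where [gam] is inverted. *)
have [T [cT TO uTT]] := uT (gam (Num.min z0 (h x0 + K / 2 * h x0 ^+ 2))).
have hT x : Omega x -> ~ T x -> h x < h x0.
  move=> Ox nTx; have := uTT x Ox nTx.
  set t := Num.min _ _ => ut.
  have h00 : 0 < h x0 + K / 2 * h x0 ^+ 2.
    by rewrite addr_gt0// mulr_gt0 ?exprn_gt0// divr_gt0.
  have t0 : 0 < t by rewrite lt_min z0_gt0.
  have tz : t <= z0 by rewrite ge_min lexx.
  have Zt : Z (u x) < t.
    rewrite ltNge; apply/negP => tZ; have := le_gam_Z t0 tZ.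
    by rewrite leNgt ut.
  have : P (Z (u x)) < h x0.
    apply: P_lt => //; first exact: ltW.
    by apply: lt_le_trans Zt _; rewrite ge_min lexx orbT.
  by have := s_ge0 _ Ox; rewrite {2}/h; lra.
pose D := [set x | s (sqdist x c) <= s1].
have cD : compact (T `&` D).
  apply: compact_closedI => //.
  apply: (@closed_comp _ _ (fun x => s (sqdist x c)) [set t | t <= s1]).
    by move=> x _; exact: s_cont.
  exact: closed_le.
have Tx0 : (T `&` D) x0.
  split; last by rewrite /D/= sx0.
  by apply: contrapT => /(hT _ Ox0); rewrite ltxx.
have [x xTD hmax] : exists2 x, x \in T `&` D &
    forall y, y \in T `&` D -> h y <= h x.
  apply: compact_EVT_max => //; first by exists x0.
  apply: continuous_in_subspaceT => y; rewrite inE/= => -[Ty _].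
  apply: (@continuousB _ _ _ (fun x => P (Z (u x))) (fun x => s (sqdist x c))).
    apply: (@continuous_comp _ _ _ u (P \o Z)); first exact/u_cont/TO.
    apply: continuous_comp; first exact: Z_cont.
    exact: P_cont.
  exact: s_cont.
move: xTD; rewrite inE => -[Tx Dx].
have Ox := TO _ Tx.
have hx0 : h x0 <= h x by apply: hmax; rewrite inE.
have {}hmax y : Omega y -> s (sqdist y c) <= s1 -> h y <= h x.
  move=> Oy sy; have [Ty|nTy] := pselect (T y).
    by apply: hmax; rewrite inE.
  by apply: le_trans hx0; apply/ltW/hT.
have ux : gam z0 < u x.
  apply: Bu => //; rewrite [leLHS]sE lerD2l ler_pM2l ?mulr_gt0//.
have [/andP[Zx0 Zxz] gZ] := Z_in ux.
have [Px0 PxE] := PQ _ (ltW Zx0).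
have Ps1 : P (Z (u x)) < s1.
  by apply: P_lt; [exact: ltW|exact: ltW|exact: lt_le_trans Zxz zs1].
(* Positivity of [h x] means [s < P (Z (u x))], which is below [s1]: the constraint [s <= s1] is
   inactive, so the maximum is local in the domain. *)
have sxs1 : s (sqdist x c) < s1.
  by have := h0; have := hx0; rewrite {2}/h; lra.
pose w t := (s t + h x) + K / 2 * (s t + h x) ^+ 2.
have shE : s (sqdist x c) + h x = P (Z (u x)) by rewrite /h addrC subrK.
have wE : w (sqdist x c) = Z (u x) by rewrite /w shE.
have sh_der t : is_derive (t : R) (1 : R) (fun t => s t + h x) (2 * rho)^-1.
  have d := @is_deriveD _ _ _ _ _ _ _ _ _ (s_der t) (is_derive_cst (h x) t 1).
  by refine (is_derive_eq d _); rewrite addr0.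
have w_der t : is_derive (t : R) (1 : R) w ((1 + K * (s t + h x)) / (2 * rho)).
  have d1 := @is_deriveM _ _ _ _ _ _ _ _ (sh_der t) (sh_der t).
  have d2 := is_derive_cM (K / 2) d1.
  have d3 := @is_deriveD _ _ _ _ _ _ _ _ _ (sh_der t) d2.
  refine (is_derive_eq d3 _); rewrite /GRing.scale/=.
  by field; rewrite gt_eqF.
have w_der2 t : is_derive (t : R) (1 : R) (fun t => (1 + K * (s t + h x)) / (2 * rho))
    (K / (2 * rho) ^+ 2).
  have d1 := is_derive_cM (K / (2 * rho)) (sh_der t).
  have d2 := @is_deriveD _ _ _ _ _ _ _ _ _ (is_derive_cst ((2 * rho)^-1) t 1) d1.
  have -> : (fun t => (1 + K * (s t + h x)) / (2 * rho)) =
    cst ((2 * rho)^-1) + (fun t => K / (2 * rho) * (s t + h x)).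
    by apply/funext => y; rewrite fctE/=; field; rewrite gt_eqF.
  by refine (is_derive_eq d2 _); field; rewrite gt_eqF.
have near_x : \forall y \near x, 0 <= 1 * (u y - gam (w (sqdist y c))).
  have n1 : \forall y \near x, s (sqdist y c) < s1.
    have cv : s (sqdist y c) @[y --> x] --> s (sqdist x c) by exact: s_cont.
    exact: (cvgr_lt _ cv _ sxs1).
  have n2 : \forall y \near x, gam z0 < u y.
    have cv : u y @[y --> x] --> u x by exact: u_cont.
    exact: (cvgr_gt _ cv _ ux).
  have n3 : \forall y \near x, w (sqdist y c) < z0.
    have cv : w (sqdist y c) @[y --> x] --> w (sqdist x c).
      apply: (@continuous_comp _ _ _ (fun x => sqdist x c) w).
        exact: sqdist_continuous.
      exact: is_derive_continuous (w_der _).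
    by apply: (cvgr_lt _ cv); rewrite wE.
  have n4 : \forall y \near x, Omega y by exact: open_nbhs_nbhs.
  near=> y; rewrite mul1r subr_ge0.
  have Oy : Omega y by near: y.
  have uy : gam z0 < u y by near: y.
  have [/andP[Zy0 Zyz] gZy] := Z_in uy.
  rewrite -[leRHS]gZy; apply: gam_anti => //.
    have hy : h y <= h x by apply: hmax => //; apply: ltW; near: y.
    apply: P_le; first exact: ltW.
      by rewrite addr_ge0 ?s_ge0// (le_trans _ hx0)// ltW.
    by move: hy; rewrite {1}/h lerBlDl.
  by apply: lt_trans z0_lt; near: y.
have tt : 0 < w (sqdist x c) < tau by rewrite wE Zx0 (lt_trans Zxz).
have uxE : u x = gam (w (sqdist x c)) by rewrite wE gZ.
have := touching_profile Ox (oner_neq0 R) w_der w_der2 tt uxE near_x.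
have [_ q0] := gam_derive tt.
have := gam_f tt.
rewrite wE gZ in q0 *; rewrite shE.
set F := f _; set A := a _; set Q := q _ in q0 *.
set t := Z _ in Zx0 PxE Ps1 Px0 *; set y := P _ in PxE Ps1 Px0 *.
have A0 : 0 < A by exact: a_gt0.
set r2 := sqdist x c.
have r2B : rho ^+ 2 <= r2 by exact: OB.
have rho20 : 0 < rho ^+ 2 by rewrite exprn_gt0.
(* This is where the shape of the barrier pays off: [(1 + K y)^2 = 1 + 2 K t] for
   [t = y + K y^2 / 2], whatever the shift. *)
have -> : 4 * r2 * ((1 + K * y) / (2 * rho)) ^+ 2 =
   r2 / rho ^+ 2 * (1 + 2 * K * t).
  by rewrite -PxE; field; rewrite gt_eqF.
have -> : 4 * r2 * (K / (2 * rho) ^+ 2) + 2 * N%:R * ((1 + K * y) / (2 * rho))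
  = r2 / rho ^+ 2 * K + N%:R / rho * (1 + K * y).
  by field; rewrite gt_eqF.
have m1 : 1 <= r2 / rho ^+ 2 by rewrite ler_pdivlMr// mul1r.
have n0 : 0 <= N%:R / rho by apply: divr_ge0; [exact: ler0n|exact: ltW].
move: m1 n0 NK; set m := r2 / _; set n := N%:R / rho => m1 n0 NK.
set AQ := A * Q; have AQ0 : 0 < AQ by rewrite mulr_gt0.
move=> hF; rewrite mul1r => H.
have F0 : 0 < F by rewrite -(pmulr_lgt0 _ Zx0); apply: lt_le_trans hF;
  rewrite mulr_gt0//; lra.
clear - F0 hF H K0 NK m1 n0 AQ0 Ps1.
(* The first-order term is at most [- 2 m K F t <= - (3/2) m K AQ]. The Laplacian contributes less
   than [(m K + K / 2) AQ], and [m >= 1]. *)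
have mK0 : 0 < m * K by rewrite mulr_gt0//; lra.
have h1 : F * (1 - m * (1 + 2 * K * t)) <= - (2 * (m * K) * (F * t)).
  have : 0 <= F * (m - 1) by rewrite mulr_ge0 ?subr_ge0// ltW.
  lra.
have h2 : 2 * (m * K) * (3 / 4 * AQ) <= 2 * (m * K) * (F * t).
  by rewrite ler_pM2l// mulr_gt0.
have h3 : n * (K * y) <= n * (K * s1).
  by apply: ler_wpM2l => //; rewrite ler_pM2l// ltW.
have h4 : AQ * (m * K + n * (1 + K * y)) < AQ * (m * K + K / 2).
  by rewrite ltr_pM2l//; lra.
have h5 : AQ * K <= AQ * (m * K).
  by rewrite ler_pM2l// ler_peMl// ltW.
lra.
Unshelve. all: by end_near. Qed.

End barriers.

(** * Distance to the boundary *)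

Section geometry.
Variables (R : realType) (N : nat).
Implicit Types (x y c v w : 'rV[R]_N) (A : set 'rV[R]_N).

Definition dot v w : R := \sum_(i < N) v 0 i * w 0 i.

Lemma dot_combination (a b : R) v w :
  dot (a *: v + b *: w) (a *: v + b *: w) =
  a ^+ 2 * dot v v + 2 * (a * b) * dot v w + b ^+ 2 * dot w w.
Proof.
rewrite /dot !mulr_sumr -!big_split; apply: eq_bigr => i _ /=.
by rewrite !mxE; ring.
Qed.

Lemma dotE x c : sqdist x c = dot (x - c) (x - c).
Proof. by apply: eq_bigr => i _; rewrite !mxE expr2. Qed.

Lemma dot_sqr v : dot v v = enorm v ^+ 2.
Proof. by rewrite sqr_enorm; apply: eq_bigr => i _; rewrite expr2. Qed.

Lemma sqdist_enorm x c : sqdist x c = enorm (x - c) ^+ 2.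
Proof. by rewrite dotE dot_sqr. Qed.

Lemma dot_le0 v : dot v v <= 0 -> v = 0.
Proof.
move=> v0; have /eqP : dot v v = 0.
  by apply/eqP; rewrite eq_le v0 sumr_ge0// => i _; rewrite -expr2 sqr_ge0.
rewrite psumr_eq0; last by move=> i _; rewrite -expr2 sqr_ge0.
move=> /allP H; apply/rowP => i; rewrite mxE.
by have := H i (mem_index_enum i); rewrite /= mulf_eq0 orbb => /eqP.
Qed.

Lemma enorm_ge0 v : 0 <= enorm v. Proof. exact: sqrtr_ge0. Qed.

Lemma enormZ (k : R) v : enorm (k *: v) = `|k| * enorm v.
Proof.
rewrite /enorm -sqrtr_sqr -sqrtrM ?sqr_ge0// mulr_sumr.
by congr Num.sqrt; apply: eq_bigr => i _; rewrite mxE exprMn.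
Qed.

Lemma enorm_distC x y : enorm (x - y) = enorm (y - x).
Proof. by rewrite -opprB -scaleN1r enormZ normrN1 mul1r. Qed.

Lemma enorm_dist_continuous c : continuous (fun x => enorm (x - c)).
Proof.
have -> : (fun x => enorm (x - c)) = (fun x => Num.sqrt (sqdist x c)).
  by apply/funext => x; rewrite sqdist_enorm sqrtr_sqr ger0_norm// enorm_ge0.
move=> x; apply: (@continuous_comp _ _ _ (fun x => sqdist x c) (@Num.sqrt R)).
  exact: sqdist_continuous.
exact: sqrt_continuous.
Qed.

(** The equality case of the triangle inequality: squaring gives [dot v w >= d rho], whence [|rho v
    - d w|^2 = 2 d rho (d rho - dot v w) <= 0]. *)
Lemma collinear_of_extremal v w (d rho : R) : 0 <= d -> 0 < rho ->
  enorm v = d -> enorm w = rho -> d + rho <= enorm (v + w) ->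
  v = (d / rho) *: w.
Proof.
move=> d0 rho0 vd wr dr.
have e : (d + rho) ^+ 2 <= enorm (v + w) ^+ 2.
  by rewrite ler_pXn2r// nnegrE ?enorm_ge0// addr_ge0// ltW.
have dvw : dot (v + w) (v + w) = d ^+ 2 + 2 * dot v w + rho ^+ 2.
  have := dot_combination 1 1 v w; rewrite !scale1r => ->.
  by rewrite !dot_sqr vd wr; ring.
rewrite -dot_sqr dvw in e.
have h : d * rho <= dot v w by lra.
have : rho *: v + (- d) *: w = 0.
  apply: dot_le0; rewrite dot_combination !dot_sqr vd wr.
  have : 0 <= d * rho * (dot v w - d * rho).
    by apply: mulr_ge0; [rewrite mulr_ge0// ltW|rewrite subr_ge0].
  lra.
move=> /eqP; rewrite scaleNr subr_eq0 => /eqP E.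
by rewrite mulrC -scalerA -E scalerA mulVf ?scale1r// gt_eqF.
Qed.

(** The crossing is at the supremum of the parameters that land in [A]. That point is adherent to
    [A], and being in the open set [A] would allow a larger parameter. *)
Lemma frontier_on_segment A x c : open A -> A x -> ~ A c ->
  exists2 t : R, 0 <= t <= 1 & frontier A (x + t *: (c - x)).
Proof.
move=> oA Ax nAc.
pose l (t : R) := x + t *: (c - x).
have l_cont : continuous l.
  have -> : l = (fun=> x) \+ (fun t => t *: (c - x)) by [].
  by move=> t; apply: continuousD; [exact: cst_continuous|exact: scalel_continuous].
pose E := [set t : R | 0 <= t <= 1 /\ A (l t)].
have E0 : E 0 by split; rewrite ?lexx ?ler01// /l scale0r addr0.
have hE : has_sup E.
  split; first by exists 0.
  by exists 1 => t [/andP[]].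
have s01 : 0 <= sup E <= 1.
  apply/andP; split; first exact: (sup_upper_bound hE).
  by apply: ge_sup => [|t [/andP[]]//]; exists 0.
exists (sup E) => //; split.
  move=> B /(l_cont (sup E))[/= e e0 He].
  have [t Et te] := sup_adherent e0 hE.
  exists (l t); split; first by case: Et.
  apply: He; rewrite /= ger0_norm ?subr_ge0; last exact: (sup_upper_bound hE).
  by rewrite ltrBlDl -ltrBlDr.
rewrite ((interior_id _).1 oA) => Al.
have s1 : sup E < 1.
  move: s01 => /andP[_]; rewrite le_eqVlt => /predU1P[s1|//].
  by move: Al; rewrite -/(l _) s1 /l scale1r addrC subrK.
have nA : \forall t \near sup E, A (l t).
  by apply: (l_cont (sup E)); exact: open_nbhs_nbhs.
have [/= e e0 He] := nA.
pose t := Num.min (sup E + e / 2) 1.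
have st : sup E < t by rewrite lt_min s1 andbT ltrDl divr_gt0.
have : E t.
  split.
    rewrite ge_min lexx orbT andbT; apply: ltW; apply: le_lt_trans st.
    by case/andP: s01.
  apply: He; rewrite /= ltr0_norm ?subr_lt0// opprB ltrBlDl.
  by rewrite gt_min ltrD2l ltr_pdivrMr// ltr_pMr// ltr1n.
move=> /(sup_upper_bound hE); rewrite leNgt => /negP; apply.
exact: st.
Qed.

(* A segment joining the centre of an interior ball to the centre of an
   exterior one crosses the boundary outside both balls. *)
Lemma centers_far A x c (d rho : R) : open A -> A x ->
  (forall y, frontier A y -> d <= enorm (x - y)) ->
  (forall y, frontier A y -> rho <= enorm (y - c)) -> ~ A c ->
  d + rho <= enorm (x - c).
Proof.
move=> oA Ax dx rc nAc; have [t /andP[t0 t1] Ft] := frontier_on_segment oA Ax nAc.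
have := dx _ Ft; have := rc _ Ft.
have -> : x + t *: (c - x) - c = (1 - t) *: (x - c).
  by apply/rowP => i; rewrite !mxE; ring.
have -> : x - (x + t *: (c - x)) = t *: (x - c).
  by apply/rowP => i; rewrite !mxE; ring.
by rewrite !enormZ !ger0_norm ?subr_ge0//; lra.
Qed.

Lemma frontier_closure A x : frontier A x -> closure A x.
Proof. by case. Qed.

Lemma compact_closure A : bounded_set A -> compact (closure A).
Proof.
move=> [M [_ HM]].
pose M1 := `|M| + 1.
have MM1 : M < M1 by rewrite (le_lt_trans (ler_norm _))// ltrDl.
have M10 : 0 <= M1 by rewrite addr_ge0.
pose B := [set x : 'rV[R]_N | sqdist x 0 <= N%:R * M1 ^+ 2].
have AB : A `<=` B.
  move=> x /(HM _ MM1) xM; rewrite /B /= /sqdist.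
  apply: (@le_trans _ _ (\sum_(i < N) M1 ^+ 2)); last first.
    by rewrite sumr_const card_ord mulr_natl.
  apply: ler_sum => i _; rewrite mxE subr0 -[_ ^+ 2]real_normK ?num_real//.
  rewrite ler_pXn2r// ?nnegrE//; apply: le_trans xM.
  rewrite [leRHS]/Num.norm/= mx_normrE.
  by apply/bigmax_geP; right; exists (0, i).
have cB : compact B by exact: sqdist_ball_compact.
apply: (subclosed_compact _ cB); first exact: closed_closure.
have clB : closed B by exact: compact_closed.
by move=> x /(closureS AB); rewrite -(closure_id _).1.
Qed.

Lemma frontier_compact A : bounded_set A -> compact (frontier A).
Proof.
move=> bA; apply: (subclosed_compact _ (compact_closure bA)).
  rewrite /frontier setDE; apply: closedI; first exact: closed_closure.
  by apply: open_closedC; exact: open_interior.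
exact: frontier_closure.
Qed.

Lemma nearest_point A x : bounded_set A -> frontier A !=set0 ->
  exists2 x0, frontier A x0 & dist_to (frontier A) x = enorm (x - x0) /\
    forall y, frontier A y -> dist_to (frontier A) x <= enorm (x - y).
Proof.
move=> bA A0.
have [|x0 Ax0 Hx0] := compact_EVT_min (f := fun y => enorm (y - x)) A0
    (frontier_compact bA).
  exact/continuous_subspaceT/enorm_dist_continuous.
rewrite inE in Ax0; exists x0 => //.
have {}Hx0 y : frontier A y -> enorm (x - x0) <= enorm (x - y).
  move=> Ay; rewrite [leLHS]enorm_distC [leRHS]enorm_distC.
  by have /= := Hx0 y; apply; rewrite inE.
have E : dist_to (frontier A) x = enorm (x - x0).
  apply/eqP; rewrite eq_le; apply/andP; split.
    apply: ge_inf; last by exists x0.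
    by exists 0 => _ [y _ <-]; exact: enorm_ge0.
  apply: lb_le_inf; first by exists (enorm (x - x0)), x0.
  by move=> _ [y Ay <-]; exact: Hx0.
by split => // y Ay; rewrite E; exact: Hx0.
Qed.

(** Stating the distance condition point by point makes the set an intersection of closed ones, so
    continuity of [dist_to] never enters. These sets are the compact sets required by the exterior
    comparison. *)
Lemma far_from_frontier_compact A (d : R) : bounded_set A ->
  compact [set x | closure A x /\ forall y, frontier A y -> d <= enorm (x - y)].
Proof.
move=> bA.
have -> : [set x | closure A x /\ forall y, frontier A y -> d <= enorm (x - y)] =
  closure A `&` \bigcap_(y in frontier A) [set x | d <= enorm (x - y)].
  by apply/seteqP; split.
apply: compact_closedI; first exact: compact_closure.
apply: closed_bigI => y _.
apply: (@closed_comp _ _ (fun x => enorm (x - y)) [set t | d <= t]).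
  by move=> x _; exact: enorm_dist_continuous.
exact: closed_ge.
Qed.

End geometry.

(** * The estimate [z = d + O(d^2)] and its consequence for [u] *)

Section distance_estimate.
Variables (R : realType) (N : nat) (Omega : set 'rV[R]_N) (u : 'rV[R]_N -> R).
Variables (a f gam q Z : R -> R) (tau z0 : R).
Hypothesis Omega_open : open Omega.
Hypothesis Omega_bounded : bounded_set Omega.
Hypothesis Omega_inner : inner_sphere_condition Omega.
Hypothesis Omega_outer : outer_sphere_condition Omega.
Hypothesis frontier_neq0 : frontier Omega !=set0.
Hypothesis u_C2 : C2_on Omega u.
Hypothesis u_blowup : u x @[x --> to_frontier Omega] --> +oo.
Hypothesis a_C1 : C1 a.
Hypothesis a_gt0 : forall s, 0 < a s.
Hypothesis u_eq : forall x, Omega x ->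
  divergence (fun y => a (u y) *: grad u y) x =
    derive1 a (u x) / 2 * enorm (grad u x) ^+ 2 + f (u x).
Hypothesis gam_derive : forall t, 0 < t < tau ->
  is_derive (t : R) (1 : R) gam (- q t) /\ 0 < q t.
Hypothesis q_derive : forall t, 0 < t < tau -> is_derive (t : R) (1 : R) q
  (q t ^+ 2 * derive1 a (gam t) / (2 * a (gam t)) - f (gam t) / a (gam t)).
Hypothesis gam_f : forall t, 0 < t < tau ->
  3 / 4 * (a (gam t) * q t) <= f (gam t) * t.
Hypothesis z0_gt0 : 0 < z0.
Hypothesis z0_lt : z0 < tau.
Hypothesis Z_in : forall s, gam z0 < s -> 0 < Z s < z0 /\ gam (Z s) = s.
Hypothesis Z_out : forall s, s <= gam z0 -> Z s = z0.
Hypothesis Z_cont : continuous Z.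

Local Notation d := (dist_to (frontier Omega)).

Lemma blowup_near_frontier A : exists2 delta : R, 0 < delta &
  forall x y, Omega x -> frontier Omega y -> enorm (x - y) < delta -> A < u x.
Proof.
have [delta /= delta0 H] : \forall x \near to_frontier Omega, A < u x.
  exact: (cvgry_gt u_blowup A).
exists delta => // x y Ox Fy xy; apply: H; split => //.
have [x0 _ [_ dle]] := nearest_point x Omega_bounded frontier_neq0.
exact: le_lt_trans (dle _ Fy) xy.
Qed.

Lemma dist_lower : exists2 L : R, 0 < L & exists2 delta : R, 0 < delta &
  forall x, Omega x -> d x < delta -> d x - L * d x ^+ 2 <= Z (u x).
Proof.
have [rho rho0 inB] := Omega_inner; have [rho' rho'0 outB] := Omega_outer.
(* The balls used below have radius at least [rho / 2], which explains the factor 2; the term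
   [1 / z0] ensures [1 < 4 K z0]. *)
pose K := 2 * (N%:R / rho) + z0^-1.
have n0 : 0 <= N%:R / rho by apply: divr_ge0; [exact: ler0n|exact: ltW].
have zi : 0 < z0^-1 by rewrite invr_gt0.
have K0 : 0 < K by rewrite /K; lra.
have Kz : 1 < 4 * K * z0.
  have e : K * z0 = 2 * (N%:R / rho) * z0 + 1 by rewrite /K mulrDl mulVf// gt_eqF.
  have : 0 <= N%:R / rho * z0 by rewrite mulr_ge0// ltW.
  lra.
pose L := rho^-1 + K.
have L0 : 0 < L by rewrite addr_gt0// invr_gt0.
exists L => //; exists (rho / 2); first by rewrite divr_gt0.
move=> x Ox dx.
have [x0 Fx0 [dE dle]] := nearest_point x Omega_bounded frontier_neq0.
have d0 : 0 <= d x by rewrite dE enorm_ge0.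
have [c xc cB] := inB _ Fx0; have [c' xc' c'B] := outB _ Fx0.
have nOc' : ~ Omega c'.
  move=> Oc'; apply: (c'B c'); last exact: subset_closure.
  by rewrite /eball/= subrr -(scale0r (0 : 'rV[R]_N)) enormZ normr0 mul0r.
have Oc : Omega c.
  by apply: cB; rewrite /eball/= subrr -(scale0r (0 : 'rV[R]_N)) enormZ normr0 mul0r.
have rc' y : frontier Omega y -> rho' <= enorm (y - c').
  move=> Fy; rewrite leNgt; apply/negP => yc'.
  by apply: (c'B y yc'); exact: frontier_closure.
have rc y : frontier Omega y -> rho <= enorm (c - y).
  move=> -[_ nIy]; rewrite leNgt; apply/negP => cy; apply: nIy.
  rewrite (interior_id _).1//; apply: cB.
  by rewrite /eball/= enorm_distC.
(* The exterior ball fixes the normal at [x0]: both [x] and the interior centre [c] are extremal in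
   the triangle inequality towards [c']. So [x] lies on the radius from [x0] to [c], at distance
   [rho - d x] from [c]. *)
have e1 : x - x0 = (d x / rho') *: (x0 - c').
  apply: collinear_of_extremal => //.
  by rewrite addrA subrK; exact: (centers_far Omega_open Ox dle rc' nOc').
have e3 : c - x0 = (rho / rho') *: (x0 - c').
  apply: collinear_of_extremal => //; first exact: ltW.
    by rewrite enorm_distC.
  by rewrite addrA subrK; exact: (centers_far Omega_open Oc rc rc' nOc').
have xcE : sqdist x c = (rho - d x) ^+ 2.
  have -> : sqdist x c = enorm (((d x - rho) / rho') *: (x0 - c')) ^+ 2.
    rewrite sqdist_enorm; congr (enorm _ ^+ 2).
    rewrite mulrBl scalerBl -e1 -e3.
    by apply/rowP => i; rewrite !mxE; ring.
  rewrite enormZ xc' exprMn real_normK ?num_real//.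
  by field; rewrite gt_eqF.
(* concentric balls of radius [rho - d + e], whose closure lies in [Omega] *)
have main e : 0 < e < d x -> e - L * e ^+ 2 <= Z (u x).
  move=> /andP[e0 ed].
  pose rho1 := rho - d x + e.
  have rho1h : rho / 2 < rho1 by rewrite /rho1; lra.
  have rho10 : 0 < rho1 by lra.
  (* Chosen so that [(rho1 - e)^2 = rho1^2 - 2 rho1 s], where [rho1 - e = rho - d x] is the distance
     from [x] to [c]. *)
  pose s := e - e ^+ 2 / (2 * rho1).
  have eq : e ^+ 2 / (2 * rho1) <= e ^+ 2 / rho.
    rewrite ler_pM2l ?exprn_gt0// lef_pV2 ?posrE//; lra.
  have eq0 : 0 <= e ^+ 2 / (2 * rho1) by rewrite divr_ge0 ?sqr_ge0//; lra.
  have e2 : e ^+ 2 / rho < e.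
    rewrite ltr_pdivrMr// expr2 ltr_pM2l//; lra.
  have s0 : 0 < s by rewrite /s; lra.
  have se : s <= e by rewrite /s; lra.
  have h := @inner_barrier R N Omega u a f gam q Z tau z0 Omega_open u_C2 a_C1
    a_gt0 u_eq gam_derive q_derive gam_f z0_gt0 z0_lt Z_in Z_out Z_cont
    c rho1 K rho10.
  have {h} : s - K * s ^+ 2 <= Z (u x).
    apply: h => //.
    - move=> y; rewrite sqdist_enorm ler_pXn2r ?nnegrE ?enorm_ge0 ?(ltW rho10)// => yc.
      by apply: cB; rewrite /eball/=; apply: le_lt_trans yc _; rewrite /rho1; lra.
    - have : N%:R / rho1 <= 2 * (N%:R / rho).
        have -> : 2 * (N%:R / rho) = N%:R / (rho / 2) by field; rewrite gt_eqF.
        apply: ler_wpM2l; first exact: ler0n.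
        by rewrite lef_pV2 ?posrE//; lra.
      by rewrite /K; lra.
    - rewrite xcE /s /rho1; field; rewrite gt_eqF//.
  have : s ^+ 2 <= e ^+ 2 by rewrite ler_pXn2r// nnegrE ltW.
  move=> s2 h; apply: le_trans h.
  have : K * s ^+ 2 <= K * e ^+ 2 by rewrite ler_pM2l.
  have : L * e ^+ 2 = e ^+ 2 / rho + K * e ^+ 2 by rewrite /L; ring.
  rewrite {2}/s; lra.
move: d0; rewrite le_eqVlt => /predU1P[<-|d0].
  rewrite expr0n/= mulr0 subr0.
  by have [/Z_out ->|/Z_in[/andP[/ltW]]] := leP (u x) (gam z0); first exact: ltW.
rewrite lerBlDr; apply/ler_addgt0Pr => t t0.
pose e := Num.max (d x - t) (d x / 2).
have ed : e < d x by rewrite gt_max; apply/andP; split; lra.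
have e0 : 0 < e by rewrite lt_max; apply/orP; right; lra.
have := main e; rewrite e0 ed => /(_ isT) h.
have : d x - t <= e by rewrite le_max lexx.
have : L * e ^+ 2 <= L * d x ^+ 2.
  by rewrite ler_pM2l// ler_pXn2r// ?nnegrE ltW.
lra.
Qed.

Lemma dist_upper : exists2 L : R, 0 < L & exists2 delta : R, 0 < delta &
  forall x, Omega x -> d x < delta -> Z (u x) <= d x + L * d x ^+ 2.
Proof.
have [rho rho0 outB] := Omega_outer.
have [delta delta0 Hdelta] := blowup_near_frontier (gam z0).
set n := N%:R / rho.
have n0 : 0 <= n by apply: divr_ge0; [exact: ler0n|exact: ltW].
(* The first bound keeps the shell [s <= s1] within [delta] of the frontier, where [u > gam z0]; the
   second makes [n * s1 <= 1 / 4]. *)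
pose s1 := Num.min (delta / 2) (1 / (4 * (n + 1))).
have s10 : 0 < s1 by rewrite lt_min !divr_gt0//; lra.
have s1d : s1 < delta by rewrite gt_min; apply/orP; left; lra.
have ns1 : n * s1 <= 1 / 4.
  have : s1 <= 1 / (4 * (n + 1)) by rewrite ge_min lexx orbT.
  rewrite ler_pdivlMr; last lra.
  have : 0 <= s1 * n by rewrite mulr_ge0// ltW.
  lra.
(* The last term lifts the barrier to [z0] at [s = s1]; [K > 4 n] together with [n s1 <= 1/4] gives
   the strict bound by [K / 2]. *)
pose K := 4 * n + 1 + 2 * z0 / s1 ^+ 2.
have zs0 : 0 < 2 * z0 / s1 ^+ 2 by rewrite !divr_gt0 ?exprn_gt0// mulr_gt0.
have K0 : 0 < K by rewrite /K; lra.
have zK : z0 <= s1 + K / 2 * s1 ^+ 2.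
  have -> : K / 2 * s1 ^+ 2 = (4 * n + 1) / 2 * s1 ^+ 2 + z0.
    by rewrite /K; field; rewrite gt_eqF.
  have : 0 <= (4 * n + 1) / 2 * s1 ^+ 2 by rewrite mulr_ge0 ?sqr_ge0//; lra.
  lra.
have NK : n * (1 + K * s1) < K / 2.
  have : K * (n * s1) <= K * (1 / 4) by rewrite ler_pM2l.
  have : 4 * n < K by rewrite /K; lra.
  lra.
pose L := (2 * rho)^-1 + 2 * K.
have L0 : 0 < L by rewrite addr_gt0 ?invr_gt0 ?mulr_gt0.
exists L => //; exists (Num.min (2 * rho) (s1 / 2)).
  by rewrite lt_min divr_gt0// mulr_gt0.
move=> x Ox; rewrite lt_min => /andP[dr ds].
have [x0 Fx0 [dE dle]] := nearest_point x Omega_bounded frontier_neq0.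
have d0 : 0 <= d x by rewrite dE enorm_ge0.
have [c xc cB] := outB _ Fx0.
have nOc : ~ Omega c.
  move=> Oc; apply: (cB c); last exact: subset_closure.
  by rewrite /eball/= subrr -(scale0r (0 : 'rV[R]_N)) enormZ normr0 mul0r.
have rc y : frontier Omega y -> rho <= enorm (y - c).
  move=> Fy; rewrite leNgt; apply/negP => yc.
  by apply: (cB y yc); exact: frontier_closure.
have rcO y : Omega y -> rho <= enorm (y - c).
  move=> Oy; rewrite leNgt; apply/negP => yc.
  by apply: (cB y yc); exact: subset_closure.
have e1 : x - x0 = (d x / rho) *: (x0 - c).
  apply: collinear_of_extremal => //.
  by rewrite addrA subrK; exact: (centers_far Omega_open Ox dle rc nOc).
have xcE : sqdist x c = (rho + d x) ^+ 2.
  have -> : sqdist x c = enorm (((d x + rho) / rho) *: (x0 - c)) ^+ 2.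
    rewrite sqdist_enorm; congr (enorm _ ^+ 2).
    rewrite mulrDl scalerDl -e1 mulfV ?gt_eqF// scale1r.
    by apply/rowP => i; rewrite !mxE; ring.
  rewrite enormZ xc exprMn real_normK ?num_real//.
  by field; rewrite gt_eqF.
(* Chosen so that [(rho + d)^2 = rho^2 + 2 rho s]. Since [d < 2 rho], also [s <= 2 d], which
   accounts for the [2 K] in [L]. *)
pose s := d x + d x ^+ 2 / (2 * rho).
have dd : d x ^+ 2 / (2 * rho) <= d x.
  by rewrite ler_pdivrMr ?mulr_gt0// expr2 ler_wpM2l// ltW.
have dd0 : 0 <= d x ^+ 2 / (2 * rho) by rewrite divr_ge0 ?sqr_ge0//; lra.
have ss1 : s <= s1 by rewrite /s; lra.
have h := @outer_barrier R N Omega u a f gam q Z tau z0 Omega_open u_C2 a_C1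
    a_gt0 u_eq gam_derive q_derive gam_f z0_gt0 z0_lt Z_in Z_out Z_cont
    c rho K s1 rho0 s10.
have {h} : Z (u x) <= s + K / 2 * s ^+ 2.
  apply: h => //.
  - move=> y /rcO yc; rewrite sqdist_enorm ler_pXn2r// nnegrE ?enorm_ge0//.
    exact: ltW.
  (* The segment from [y] to [c] meets the frontier at distance at least [rho] from [c], while
     [|y - c| <= rho + s1]; the crossing is thus within [s1 < delta] of [y]. *)
  - move=> y Oy yc.
    have [t /andP[t0 t1] Ft] := frontier_on_segment Omega_open Oy nOc.
    apply: (Hdelta _ _ Oy Ft).
    have -> : y - (y + t *: (c - y)) = t *: (y - c).
      by apply/rowP => i; rewrite !mxE; ring.
    have := rc _ Ft.
    have -> : y + t *: (c - y) - c = (1 - t) *: (y - c).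
      by apply/rowP => i; rewrite !mxE; ring.
    rewrite !enormZ !ger0_norm ?subr_ge0// => yr.
    have : enorm (y - c) <= rho + s1.
      rewrite -(@ler_pXn2r _ 2)// ?nnegrE ?enorm_ge0 ?addr_ge0 ?(ltW rho0) ?(ltW s10)//.
      rewrite -sqdist_enorm; apply: (le_trans yc).
      by have := sqr_ge0 s1; lra.
    lra.
  - move=> A; have [dA dA0 HA] := blowup_near_frontier A.
    exists [set x | closure Omega x /\ forall y, frontier Omega y -> dA <= enorm (x - y)].
    split; first exact: far_from_frontier_compact.
      move=> y [cy fy]; apply: contrapT => nOy.
      have /fy : frontier Omega y by split => //; rewrite (interior_id _).1.
      rewrite subrr -(scale0r (0 : 'rV[R]_N)) enormZ normr0 mul0r.
      by rewrite leNgt dA0.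
    move=> y Oy nT; apply: contrapT => nA; apply: nT; split.
      exact: subset_closure.
    move=> z Fz; rewrite leNgt; apply/negP => yz; apply: nA.
    exact: HA Fz yz.
  - by rewrite xcE /s; field; rewrite gt_eqF.
move=> h; apply: (le_trans h).
have : s ^+ 2 <= (2 * d x) ^+ 2.
  by rewrite ler_pXn2r// ?nnegrE /s; lra.
rewrite -(ler_pM2l K0) => h2.
have : L * d x ^+ 2 = d x ^+ 2 / (2 * rho) + 2 * K * d x ^+ 2 by rewrite /L; ring.
rewrite {1}/s; lra.
Qed.

(** Both [z] and [d] lie in [[d/2, 3d/2]], where [q <= 4 e' / d^2], and they differ by at most
    [L d^2]. The powers of [d] cancel in the mean value bound. *)
Lemma profile_error : t ^+ 2 * q t @[t --> 0^'+] --> 0 ->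
  u x - gam (d x) @[x --> to_frontier Omega] --> 0.
Proof.
move=> q0.
have [L1 L10 [d1 d10 low]] := dist_lower.
have [L2 L20 [d2 d20 up]] := dist_upper.
have [d3 d30 Hd3] := blowup_near_frontier (gam z0).
pose L := L1 + L2.
have L0 : 0 < L by rewrite addr_gt0.
apply/cvgrPdist_lt => e e0.
(* The final bound is [4 e' L = 4/5 e]; the 5 instead of 4 makes it strict. *)
pose e' := e / (5 * L).
have e'0 : 0 < e' by rewrite divr_gt0// mulr_gt0.
have [t0 /= t00 Ht0] : \forall t \near (0 : R)^'+, t ^+ 2 * q t < e'.
  exact: (cvgr_lt _ q0 _ e'0).
(* The bound [1 / (2 L)] gives [L d^2 <= d / 2]; halving [tau] and [t0] keeps the whole interval up
   to [3d/2] in range. *)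
pose D := Num.min (Num.min d1 (Num.min d2 d3))
  (Num.min (tau / 2) (Num.min (t0 / 2) (1 / (2 * L)))).
exists D => /=.
  rewrite !lt_min d10 d20 d30 !divr_gt0 ?mulr_gt0//.
  exact: lt_trans z0_gt0 z0_lt.
move=> x [Ox]; rewrite !lt_min.
move=> /andP[/andP[dd1 /andP[dd2 dd3]] /andP[dtau /andP[dt0 dL]]].
have [x0 Fx0 [dE dle]] := nearest_point x Omega_bounded frontier_neq0.
have ux : gam z0 < u x by apply: (Hd3 _ _ Ox Fx0); rewrite -dE.
have [/andP[Z0 _] gZ] := Z_in ux.
have d0 : 0 < d x.
  have : 0 <= d x by rewrite dE enorm_ge0.
  rewrite le_eqVlt => /predU1P[d0|//].
  have : Omega x0.
    suff -> : x0 = x by [].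
    apply/eqP; rewrite eq_sym -subr_eq0; apply/eqP/dot_le0.
    by rewrite dot_sqr -dE -d0 expr0n.
  by case: Fx0 => _; rewrite (interior_id _).1.
set z := Z (u x) in gZ Z0; set dx := d x in dd1 dd2 dd3 dtau dt0 dL dE dle d0 *.
have zd : `|z - dx| <= L * dx ^+ 2.
  have P1 : 0 <= L1 * dx ^+ 2 by rewrite mulr_ge0 ?sqr_ge0// ltW.
  have P2 : 0 <= L2 * dx ^+ 2 by rewrite mulr_ge0 ?sqr_ge0// ltW.
  have l : dx - L1 * dx ^+ 2 <= z by exact: low.
  have r : z <= dx + L2 * dx ^+ 2 by exact: up.
  rewrite ler_norml /L; apply/andP; split; lra.
have Ld : L * dx ^+ 2 <= dx / 2.
  have : L * dx <= 1 / 2 by move: dL; rewrite ltr_pdivlMr ?mulr_gt0//; lra.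
  by rewrite -(ler_pM2r d0); lra.
rewrite sub0r normrN -gZ.
have {}dtau : dx * 2 < tau by lra.
have {}dt0 : dx * 2 < t0 by lra.
have q_le y : dx / 2 <= y -> y <= 3 / 2 * dx -> q y <= 4 * e' / dx ^+ 2.
  move=> y1 y2.
  have y0 : 0 < y by lra.
  have yt0 : y < t0 by lra.
  have ytau : 0 < y < tau by rewrite y0/=; lra.
  have : y ^+ 2 * q y < e' by apply: Ht0 => //=; rewrite sub0r normrN gtr0_norm.
  have [_ q_gt0] := gam_derive ytau.
  rewrite ler_pdivlMr ?exprn_gt0//.
  have : (dx / 2) ^+ 2 * q y <= y ^+ 2 * q y.
    by rewrite (ler_pM2r q_gt0) ler_pXn2r ?nnegrE// ltW// divr_gt0.
  lra.
have d_ge : dx / 2 <= dx <= 3 / 2 * dx by apply/andP; split; lra.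
have z_ge : dx / 2 <= z <= 3 / 2 * dx.
  by move: zd; rewrite ler_norml => /andP[? ?]; apply/andP; split; lra.
have main y1 y2 : dx / 2 <= y1 <= 3 / 2 * dx -> dx / 2 <= y2 <= 3 / 2 * dx ->
    y1 <= y2 -> `|y2 - y1| <= L * dx ^+ 2 -> `|gam y1 - gam y2| < e.
  move=> /andP[y1l y1u] /andP[y2l y2u] y12; rewrite ger0_norm ?subr_ge0// => y12L.
  have M0 : 0 < 4 * e' / dx ^+ 2 by apply: divr_gt0; [exact: mulr_gt0|exact: exprn_gt0].
  apply: (@le_lt_trans _ _ (4 * e' / dx ^+ 2 * (y2 - y1))).
    apply: (profile_increment_le gam_derive) => //.
    - by lra.
    - by lra.
    - by move=> y /andP[y1y yy2]; apply: q_le; [exact: le_trans y1y|exact: le_trans y2u].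
  apply: (@le_lt_trans _ _ (4 * e' / dx ^+ 2 * (L * dx ^+ 2))); first by rewrite ler_pM2l.
  have -> : 4 * e' / dx ^+ 2 * (L * dx ^+ 2) = 4 / 5 * e.
    by rewrite /e'; field; rewrite !gt_eqF.
  by lra.
have [zd'|dz] := leP z (dx).
  by apply: main => //; rewrite distrC.
by rewrite distrC; apply: main => //; exact: ltW.
Qed.

End distance_estimate.

Theorem theorem1p5 (R : realType) (N : nat) (hN : (1 <= N)%N)
  (Omega : set 'rV[R]_N)
  (Omega_domain : is_domain Omega)
  (Omega_bounded : bounded_set Omega)
  (Omega_inner : inner_sphere_condition Omega)
  (Omega_outer : outer_sphere_condition Omega)
  (a f : R -> R)
  (a_C1 : C1 a)
  (nu : R) (nu_gt0 : 0 < nu) (a_ge_nu : forall s, nu <= a s)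
  (f_C1 : C1 f)
  (g : R -> R)
  (g_ode : forall t : R, is_derive t (1 : R) g (1 / Num.sqrt (a (g t))))
  (g0 : g 0 = 0)
  (r : R) (fr_gt0 : 0 < f r) (f_ge0 : forall s, r < s -> 0 <= f s)
  (eta : R -> R)
  (eta_ode : \forall t \near 0^'+,
     is_derive t (1 : R) eta (- Num.sqrt (2 * primitive_from r f (g (eta t)))))
  (eta_lim : eta t @[t --> 0^'+] --> +oo)
  (situations : exists a_inf f_inf : R, [/\ 0 < a_inf, 0 < f_inf &
    [\/ exists k beta : R, [/\ 0 < k, 0 < beta,
          a s / s `^ k @[s --> +oo] --> a_inf &
          f s / expR (2 * beta * s) @[s --> +oo] --> f_inf],
        exists k p : R, [/\ 0 < k, 2 * k + 3 < p,
          a s / s `^ k @[s --> +oo] --> a_inf &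
          f s / s `^ p @[s --> +oo] --> f_inf],
        exists gamma beta : R, [/\ 0 < gamma, 2 * gamma < beta,
          a s / expR (2 * gamma * s) @[s --> +oo] --> a_inf &
          f s / expR (2 * beta * s) @[s --> +oo] --> f_inf] |
        (exists gamma beta : R, [/\ 0 < gamma, 0 < beta,
          a s / (ln s) `^ (2 * gamma) @[s --> +oo] --> a_inf &
          f s / expR (2 * beta * s) @[s --> +oo] --> f_inf]) \/
        (exists gamma p : R, [/\ 0 < gamma, 3 < p,
          a s / (ln s) `^ (2 * gamma) @[s --> +oo] --> a_inf &
          f s / s `^ p @[s --> +oo] --> f_inf])]])
  (u : 'rV[R]_N -> R)
  (u_C2 : C2_on Omega u)
  (u_eq : forall x, Omega x ->
     divergence (fun y => a (u y) *: grad u y) x =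
       derive1 a (u x) / 2 * enorm (grad u x) ^+ 2 + f (u x))
  (u_blowup : u x @[x --> to_frontier Omega] --> +oo) :
  u x - g (eta (dist_to (frontier Omega) x)) @[x --> to_frontier Omega] --> 0.
Proof.
have [[x1 Ox1] oOmega _] := Omega_domain.
have a_gt0 s : 0 < a s by exact: lt_le_trans (a_ge_nu s).
have f_cont : continuous f.
  by move=> s; exact: is_derive_continuous (C1_is_derive s f_C1).
have [a_inf [f_inf [a_inf0 f_inf0 sit]]] := situations.
have [prof a_mono] := situations_growth_profile a_inf0 f_inf0 sit.
have [facts tq] := profile_facts a_C1 nu_gt0 a_ge_nu f_cont g_ode g0 eta_ode
  eta_lim prof a_mono.
have gy := profile_cvgy a_C1 nu_gt0 a_ge_nu g_ode g0 eta_lim.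
have [tau /= tau0 Htau] := facts.
have inH t : 0 < t < tau -> ball (0 : R) tau t /\ 0 < t.
  move=> /andP[t0 tt]; split => //.
  by rewrite -ball_normE /= sub0r normrN gtr0_norm.
have gd t : 0 < t < tau -> is_derive (t : R) (1 : R) (profile g eta)
    (- profile_slope a f g eta r t) /\ 0 < profile_slope a f g eta r t.
  by move=> /inH[tb t0]; have [] := Htau t tb t0.
have qd t : 0 < t < tau -> is_derive (t : R) (1 : R) (profile_slope a f g eta r)
    (profile_slope a f g eta r t ^+ 2 * derive1 a (profile g eta t) /
       (2 * a (profile g eta t)) -
     f (profile g eta t) / a (profile g eta t)).
  by move=> /inH[tb t0]; have [] := Htau t tb t0.
have gf t : 0 < t < tau ->
    3 / 4 * (a (profile g eta t) * profile_slope a f g eta r t) <= f (profile g eta t) * t.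
  by move=> /inH[tb t0]; have [] := Htau t tb t0.
have z00 : 0 < tau / 2 by rewrite divr_gt0.
have z0tau : tau / 2 < tau by lra.
have [Z [Z_in Z_out Z_cont]] := profile_inverse gd gy z00 z0tau.
(* With an empty frontier, [to_frontier Omega] is the principal filter of
   [Omega], on which [u] cannot tend to infinity. *)
have frontier_neq0 : frontier Omega !=set0.
  apply/set0P/negP => /eqP F0.
  have [delta /= delta0 H] : \forall x \near to_frontier Omega, u x1 < u x.
    exact: (cvgry_gt u_blowup (u x1)).
  suff : u x1 < u x1 by rewrite ltxx.
  by apply: H; split => //; rewrite /dist_to F0 image_set0 inf0.
exact: (profile_error oOmega Omega_bounded Omega_inner Omega_outer frontier_neq0
  u_C2 u_blowup a_C1 a_gt0 u_eq gd qd gf z00 z0tau Z_in Z_out Z_cont tq).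
Qed.
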